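(* Let $a_n$ be the number of pop-stacked permutations of $[n]=\{1,\dots,n\}$ and let $F(x)=\sum_{n\ge 0}a_nx^n\in\mathbb{Q}[[x]]$. If $k\ge 0$ and $p_0(x),\dots,p_k(x),q(x)\in\mathbb{Q}[x]$ with $p_k\neq 0$ satisfy \[ p_k(x)F^{(k)}(x)+\cdots+p_1(x)F'(x)+p_0(x)F(x)+q(x)=0, \] where $F^{(j)}$ denotes the $j$-th formal derivative of $F$, and $d=\max(\deg q,\deg p_0,\dots,\deg p_k)$, then $(k+2)(d+1)>1000$.
   Context: For a permutation $\pi=a_1a_2\cdots a_n$ of $[n]$, a descending run of $\pi$ is a maximal sequence of consecutive letters $a_i>a_{i+1}>\cdots>a_{i+j}$. Factor $\pi$ into its descending runs, $\pi=D_1D_2\cdots D_r$; the pop-stack operator $P$ reverses each run, i.e. $P(\pi)$ is the concatenation of the reversals of $D_1,D_2,\dots,D_r$ in this order. A permutation $\sigma$ of $[n]$ is pop-stacked if $\sigma=P(\pi)$ for some permutation $\pi$ of $[n]$. The empty permutation is counted as pop-stacked, so $a_0=1$. *)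

(* Defs.v *)
From mathcomp Require Import all_boot all_order all_algebra all_fingroup.

Set Implicit Arguments.
Unset Strict Implicit.
Unset Printing Implicit Defensive.

Import GRing.Theory.

Fixpoint desc_runs (s : seq nat) : seq (seq nat) :=
  match s with
  | [::] => [::]
  | x :: s' =>
      match desc_runs s' with
      | (y :: r) :: rs =>
          if y < x then (x :: y :: r) :: rs else [:: x] :: (y :: r) :: rs
      | rs => [:: x] :: rs
      end
  end.

Definition pop_stack (s : seq nat) : seq nat :=
  flatten [seq rev D | D <- desc_runs s].

(* 'S_n permutes {0, ..., n-1}; the shift gives a word on {1, ..., n}. *)
Definition word n (s : 'S_n) : seq nat := [seq (s i).+1 | i <- enum 'I_n].

Definition pop_stacked n (s : 'S_n) : bool :=
  [exists t : 'S_n, word s == pop_stack (word t)].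

Definition num_pop_stacked (n : nat) : nat := #|[set s : 'S_n | pop_stacked s]|.

Local Open Scope ring_scope.

(* A formal power series over rat is its sequence of coefficients. *)
Definition fps := nat -> rat.

Definition fps_poly (p : {poly rat}) : fps := fun n => p`_n.

Definition fps_add (f g : fps) : fps := fun n => f n + g n.

Definition fps_mul (f g : fps) : fps :=
  fun n => \sum_(i < n.+1) f i * g (n - i)%N.

Definition fps_sum m (f : 'I_m -> fps) : fps := fun n => \sum_(j < m) f j n.

Definition fps_deriv (f : fps) : fps := fun n => n.+1%:R * f n.+1.

Definition fps_derivn (j : nat) (f : fps) : fps := iter j fps_deriv f.

Definition pop_stacked_gf : fps := fun n => (num_pop_stacked n)%:R.

(* This gives the zero polynomial degree 0, not -oo: harmless in a maximum of
   degrees of polynomials that are not all zero. *)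
Definition degree (p : {poly rat}) : nat := (size p).-1.

(* Main.v *)
From HB Require Import structures.
Require Import Defs.
From mathcomp Require Import all_boot all_order all_algebra all_fingroup all_field.
From mathcomp Require Import zify ring.
From mathcomp Require Import boolp.

(* The power series [F] satisfies no linear differential equation with polynomial
   coefficients at all, so the hypotheses are contradictory.

   A permutation is pop-stacked iff any two adjacent ascending runs overlap as
   intervals.  Let [H i j] be the number of such permutations of [i + j + 1]
   letters whose first run has its maximum above exactly [i] letters.  Then
   [H (i+1) j = H i (j+1) + sum_k C(i,k) H j k], that is, [L H = e^x H^T] for the
   exponential generating function in [x] and [y], with [L = d/dx - d/dy]; hence
   [L^2 H = L H - e^(x+y) H].  On the line [x + y = tau] this is a linear equation
   with constant coefficients.  With [q = e^tau], [rho (1 - rho) = q] and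
   [E = e^(tau rho)], its solution gives [B = H(tau, 0)] by
   [B (E + 1 - rho) = (1 - rho) (E + rho)], and the exponential generating function
   [A] of the pop-stacked permutations by [q A = 2 B - 1].

   The series [rho], [tau], [E] are algebraically independent, and [A] has a simple
   pole along [E + 1 - rho = 0].  Each derivation raises the order of this pole by
   one, so the derivatives of [A] are independent over the rational functions of
   [tau]; but an equation for [F] would give such a relation, because [d/dx] acts on
   the coefficients of [F] as [(d/dtau) tau (d/dtau)] acts on those of [A], and
   division by [x] as [d/dtau]. *)

(** * Overlapping runs *)

Fixpoint runs (r : rel nat) (s : seq nat) : seq (seq nat) :=
  match s with
  | [::] => [::]
  | x :: s' =>
      match runs r s' with
      | (y :: t) :: ts =>
          if r x y then (x :: y :: t) :: ts else [:: x] :: (y :: t) :: ts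
      | ts => [:: x] :: ts
      end
  end.

Lemma desc_runsE s : desc_runs s = runs (fun x y => y < x) s.
Proof. by elim: s => //= x s ->. Qed.

Definition run_blocks (r : rel nat) (bs : seq (seq nat)) :=
  all (fun B => (B != [::]) && sorted r B) bs.

Definition separated (r : rel nat) (bs : seq (seq nat)) :=
  sorted (fun B C => ~~ r (last 0 B) (head 0 C)) bs.

(** With [runsP], this makes [runs r] the unique factorisation into maximal [r]-runs. It serves
    descending runs in [pop_stack] and ascending runs in [flatten_overlap_inj]. *)
Lemma runs_flatten (r : rel nat) bs :
  run_blocks r bs -> separated r bs -> runs r (flatten bs) = bs.
Proof.
elim: bs => //= B bs IH /andP[/andP[B0 sB] rbs] sep.
have {}IH : runs r (flatten bs) = bs by apply: IH => //; exact: path_sorted sep.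
case: B B0 sB sep => // x B _ /=.
elim: B x => [|y B IHB] x /=.
  rewrite {}IH => _; rewrite /run_blocks in rbs.
  by case: bs rbs => [|[|z C] bs] //= _ /andP[/negPf ->].
by case/andP=> rxy pB sep; rewrite (IHB y pB) ?rxy //; case: (bs) sep.
Qed.

Lemma runsP (r : rel nat) s :
  [/\ flatten (runs r s) = s, run_blocks r (runs r s)
    & separated r (runs r s)].
Proof.
elim: s => //= x s; rewrite /run_blocks /separated.
case: (runs r s) => [|[|y t] ts] //= [<- // /andP[pt rts] sep].
case: ifP => rxy /=; last by rewrite pt rts rxy.
by rewrite rxy pt rts; split=> //; case: (ts) sep.
Qed.

(* [bs] is a list of ascending runs in which each run meets the next one in
   a descent and overlaps it; [mn] and [mx] stand for the minimum and the
   maximum of a run preceding [bs]. *)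
Fixpoint overlap (mn mx : nat) (bs : seq (seq nat)) :=
  if bs is B :: bs' then
    [&& head 0 B < mx, mn < last 0 B & overlap (head 0 B) (last 0 B) bs']
  else true.

Definition asc_blocks := run_blocks ltn.

Lemma overlap_separated mn mx bs :
  overlap mn mx bs -> separated ltn bs.
Proof.
case: bs => //= B bs /and3P[_ _].
elim: bs B => //= C bs IH B /and3P[h1 h2 h3].
by rewrite -leqNgt ltnW //= IH.
Qed.

Lemma flatten_overlap_inj mn mx bs bs' :
  asc_blocks bs -> overlap mn mx bs -> asc_blocks bs' -> overlap mn mx bs' ->
  flatten bs = flatten bs' -> bs = bs'.
Proof.
move=> a o a' o' e.
rewrite -(runs_flatten _ _ a (overlap_separated _ _ _ o)) e.
by rewrite (runs_flatten _ _ a' (overlap_separated _ _ _ o')).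
Qed.

Lemma head_rev (s : seq nat) : head 0 (rev s) = last 0 s.
Proof. by case/lastP: s => // s x; rewrite rev_rcons last_rcons. Qed.

Lemma last_rev (s : seq nat) : last 0 (rev s) = head 0 s.
Proof. by rewrite -{2}(revK s) head_rev. Qed.

Lemma rev_nil (s : seq nat) : (rev s == [::]) = (s == [::]).
Proof. by rewrite -!size_eq0 size_rev. Qed.

(** For adjacent blocks [B], [C], the overlap condition [head 0 B < last 0 C] keeps [rev B] and
    [rev C] in different descending runs, so the operator reverses exactly the given blocks. This
    provides a preimage. *)
Lemma pop_stack_overlap mn mx bs : asc_blocks bs -> overlap mn mx bs ->
  pop_stack (flatten (map rev bs)) = flatten bs.
Proof.
move=> a o; rewrite /pop_stack desc_runsE runs_flatten.
- by rewrite -map_comp (eq_map (g := id)) ?map_id // => s /=; rewrite revK.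
- rewrite /run_blocks all_map; apply: sub_all a => B /= /andP[B0 sB].
  by rewrite rev_nil B0 rev_sorted.
- case: bs {a} o => //= B bs /and3P[_ _].
  elim: bs B => //= C bs IH B /and3P[h1 h2 h3].
  by rewrite last_rev head_rev -leqNgt ltnW //= IH.
Qed.

Lemma sorted_head_last (A : seq nat) : sorted ltn A -> head 0 A <= last 0 A.
Proof.
case: A => //= x A /(order_path_min ltn_trans) /allP h.
by case: (lastP A) h => //= s y h; rewrite last_rcons ltnW // h // mem_rcons inE eqxx.
Qed.

(* Consecutive blocks that do not meet in a descent are merged. *)
Lemma merge_blocks A As : asc_blocks (A :: As) -> uniq (flatten (A :: As)) ->
  path (fun B C => head 0 B < last 0 C) A As ->
  exists B bs, [/\ asc_blocks (B :: bs), flatten (B :: bs) = flatten (A :: As),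
    overlap (head 0 B) (last 0 B) bs, head 0 B = head 0 A & last 0 A <= last 0 B].
Proof.
elim: As A => [|C As IH] A.
  by move=> a _ _; exists A, [::]; split.
rewrite [asc_blocks _]/= => /andP[/andP[A0 sA] a] u /= /andP[hAC p].
have uC : uniq (flatten (C :: As)) by move: u; rewrite cat_uniq => /and3P[].
have [B [bs [/= /andP[/andP[B0 sB] abs] e o hB lB]]] := IH C a uC p.
have ne : last 0 A != head 0 B.
  move: u => /=; rewrite -e cat_uniq => /and3P[_ /hasPn h _].
  have hBin : head 0 B \in B ++ flatten bs by case: (B) B0 => //= x s _; rewrite inE eqxx.
  apply: contraNneq (h _ hBin) => /= <-.
  by case: (lastP A) A0 => // s x _; rewrite last_rcons mem_rcons inE eqxx.
case: (ltnP (last 0 A) (head 0 B)) => lt.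
  exists (A ++ B), bs; split => /=.
  - rewrite abs andbT; apply/andP; split; first by case: (A) A0.
    case: (A) A0 sA lt => //= x A' _ pA lt; rewrite cat_path pA /=.
    by case: (B) B0 sB lt => //= y B' _ -> ->.
  - by rewrite -catA e.
  - have -> : last 0 (A ++ B) = last 0 B by rewrite last_cat; case: (B) B0.
    have hAB : head 0 (A ++ B) < head 0 B.
      apply: leq_ltn_trans lt; have := sorted_head_last _ sA.
      by case: (A) A0.
    case: (bs) o => //= D bs' /and3P[-> h2 ->].
    by rewrite (ltn_trans hAB h2).
  - by case: (A) A0.
  - have -> : last 0 (A ++ B) = last 0 B by rewrite last_cat; case: (B) B0.
    exact: ltnW (leq_trans lt (sorted_head_last _ sB)).
exists A, (B :: bs); split => //=.
- by rewrite A0 sA B0 sB.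
- by rewrite e.
- by rewrite o andbT ltn_neqAle eq_sym ne lt (leq_trans hAC lB).
Qed.

Lemma pop_stack_perm v : perm_eq (pop_stack v) v.
Proof.
have [e _ _] := runsP (fun x y => y < x) v; rewrite -desc_runsE in e.
rewrite -{2}e /pop_stack; elim: (desc_runs v) => //= D ds IH.
by apply: perm_cat => //; rewrite perm_rev.
Qed.

(** Adjacent descending runs meet in an ascent, which becomes [head < last] for their reversals, the
    hypothesis of [merge_blocks]. The sentinels 0 and [n.+1] impose nothing on the first block. *)
Lemma overlap_of_pop_stack n v : uniq v -> all (fun x => 0 < x <= n) v ->
  exists bs, [/\ asc_blocks bs, overlap 0 n.+1 bs & flatten bs = pop_stack v].
Proof.
move=> u al; have := runsP (fun x y => y < x) v; rewrite -desc_runsE.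
have pv := pop_stack_perm v.
have up : uniq (pop_stack v) by rewrite (perm_uniq pv).
have alp : all (fun x => 0 < x <= n) (pop_stack v) by rewrite (perm_all _ pv).
move: up alp; rewrite /pop_stack; case: (desc_runs v) => [|D ds] up alp [_ rb sep].
  by exists [::]; split.
have uf : uniq (flatten (D :: ds)).
  suff /perm_uniq -> : perm_eq (flatten (D :: ds)) (flatten (map rev (D :: ds))) by [].
  by elim: (D :: ds) => //= C cs IH; apply: perm_cat => //; rewrite perm_sym perm_rev.
have pth : path (fun B C => head 0 B < last 0 C) (rev D) (map rev ds).
  elim: ds D rb sep uf {up alp} => //= C ds IH D /andP[/andP[D0 _]] rb /andP[DC sep].
  rewrite cat_uniq => /and3P[_ /hasPn h uf]; rewrite head_rev last_rev IH // andbT.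
  have C0 : C != [::] by case/andP: rb => /andP[].
  have hC : head 0 C \in C ++ flatten ds by case: (C) C0 => //= x s _; rewrite inE eqxx.
  have ne : head 0 C != last 0 D.
    apply: contraNneq (h _ hC) => /= ->.
    by case: (lastP D) D0 => // s x _; rewrite last_rcons mem_rcons inE eqxx.
  by rewrite ltn_neqAle eq_sym ne leqNgt.
have [|B [bs [a e o hB lB]]] := merge_blocks (rev D) (map rev ds) _ up pth.
  move: rb; rewrite -[rev D :: _]/(map rev (D :: ds)).
  rewrite /asc_blocks /run_blocks all_map; apply: sub_all => C /= /andP[C0 sC].
  by rewrite rev_nil C0 rev_sorted.
have Bin x : x \in B -> 0 < x <= n.
  move=> xB; apply: (allP alp); rewrite -[flatten _]e /=.
  by rewrite mem_cat xB.
exists (B :: bs); split => //=; rewrite o andbT.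
move: a => /= /andP[/andP[B0 _] _].
case: (B) B0 Bin => // x B' _ Bin; apply/andP; split.
  by have /andP[_] := Bin x (mem_head _ _); rewrite ltnS.
by have /andP[] := Bin _ (mem_last x B').
Qed.

(** * Enumeration of overlapping blocks by masks *)

Fixpoint masks n : seq (seq bool) :=
  if n is n'.+1 then map (cons true) (masks n') ++ map (cons false) (masks n')
  else [:: [::]].

Lemma mem_masks n m : (m \in masks n) = (size m == n).
Proof.
elim: n m => [|n IH] m; first by rewrite inE size_eq0.
rewrite /= mem_cat; case: m => [|b m].
  by apply/negP => /orP[]/mapP[].
have inj (c : bool) : injective (cons c) by move=> s t [].
have no c s : (c :: s \in map (cons (~~ c)) (masks n)) = false.
  by apply/negP => /mapP[t _ [/esym]]; case: (c).
by case: b; rewrite (mem_map (inj _)) no ?orbF IH.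
Qed.

Lemma uniq_masks n : uniq (masks n).
Proof.
elim: n => //= n IH.
have inj (c : bool) : injective (cons c) by move=> s t [].
rewrite cat_uniq !(map_inj_uniq (inj _)) IH /= andbT.
by apply/hasPn => m /mapP[t _ ->]; apply/negP => /mapP[].
Qed.

Arguments masks : simpl never.

(* For a mask [m] of a sorted list, [lo m], [za m] and [cn m] count the
   rejected values below the selected ones, above them, and altogether. *)
Notation lo m := (find id m).
Notation za m := (find id (rev m)).
Notation cn m := (count negb m).

Section MaskOrder.

Variables (r : rel nat) (x0 : nat).
Hypotheses (r_trans : transitive r) (r_irr : irreflexive r)
  (r_total : forall x y, x != y -> r x y || r y x).

(** The first selected value has index [lo m] in [V], so it precedes [y] iff more than [lo m] values
    do. The order is abstract so that [gtn] on the reversed list handles the last selected value. *)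
Lemma head_mask_lt (m : bitseq) V y : sorted r V -> size m = size V -> has id m ->
  y \notin V -> r (head x0 (mask m V)) y = (lo m + count (r y) V < size V).
Proof.
elim: V m => [|v V IH] [|b m] //= pV [sz] hm; rewrite inE negb_or => /andP[yv yV].
have all_gt : r y v -> count (r y) V = size V.
  move=> yv'; apply/eqP; rewrite -all_count.
  apply: sub_all (order_path_min r_trans pV) => z; exact: r_trans.
case: b hm => /= hm.
  have cV := count_size (r y) V.
  have := r_total _ _ yv; case E: (r v y) => /=; last by rewrite orbF => /[dup]/all_gt -> ->; lia.
  by have -> : r y v = false by apply/negP => /(r_trans _ _ _ E); rewrite r_irr.
rewrite (IH m) ?(path_sorted pV) //.
by case E: (r y v) => /=; [rewrite (all_gt E)|]; lia.
Qed.

Lemma count_lt_head_mask (m : bitseq) V : sorted r V -> size m = size V -> has id m ->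
  count (r^~ (head x0 (mask m V))) (mask (map negb m) V) = lo m.
Proof.
elim: V m => [|v V IH] [|b m] //= pV [sz] hm.
have all_gt := order_path_min r_trans pV.
case: b hm => /= hm.
  apply/eqP; rewrite -leqn0 leqNgt -has_count; apply/hasPn => z /mem_mask zV.
  by apply/negP => /(r_trans _ _ _ (allP all_gt _ zV)); rewrite r_irr.
rewrite (IH m) ?(path_sorted pV) // (allP all_gt) //.
have : head x0 (mask m V) \in mask m V.
  have : size (mask m V) != 0 by rewrite size_mask // -lt0n -has_count.
  by case: (mask m V) => //= z s; rewrite inE eqxx.
exact: mem_mask.
Qed.

End MaskOrder.

(* The first argument only bounds the recursion. *)
Fixpoint arrangements_fuel k n a c : nat :=
  if k is k'.+1 then
    (n == 0) + \sum_(m <- masks n | (lo m + c < n) && (za m + a < n))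
      arrangements_fuel k' (cn m) (lo m) (za m)
  else 0.

(* The number of ways to arrange [n] values after a run, [a] of them below its
   minimum and [c] of them above its maximum: the next run is selected among
   the [n] values by the mask [m]. *)
Definition arrangements n a c := arrangements_fuel n.+1 n a c.

Fixpoint blocks k (V : seq nat) mn mx : seq (seq (seq nat)) :=
  if k is k'.+1 then
    nseq (size V == 0) [::] ++
    [seq mask m V :: bs | m <- [seq m <- masks (size V) |
         [&& has id m, head 0 (mask m V) < mx & mn < last 0 (mask m V)]],
       bs <- blocks k' (mask (map negb m) V) (head 0 (mask m V)) (last 0 (mask m V))]
  else [::].

Lemma last_mask (m : bitseq) (V : seq nat) : size m = size V ->
  last 0 (mask m V) = head 0 (mask (rev m) (rev V)).
Proof. by move=> sz; rewrite -rev_mask // head_rev. Qed.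

Lemma sorted_mask_ltn (m : bitseq) V : sorted ltn V -> sorted ltn (mask m V).
Proof. exact: (subseq_sorted ltn_trans (mask_subseq _ _)). Qed.

(** The overlap conditions depend only on how many remaining values lie below [mn] and above [mx],
    and [lo m], [za m] are these numbers for the next block. *)
Lemma size_blocks k V mn mx : sorted ltn V -> mn \notin V -> mx \notin V ->
  size (blocks k V mn mx) =
  arrangements_fuel k (size V) (count (fun x => x < mn) V) (count (fun x => mx < x) V).
Proof.
elim: k V mn mx => //= k IH V mn mx sV mnV mxV.
rewrite size_cat size_nseq size_allpairs_dep sumnE big_map big_filter; congr (_ + _).
have gtn_trans : transitive gtn by move=> a b c /= h1 h2; apply: ltn_trans h1.
have sR : sorted gtn (rev V) by rewrite rev_sorted.
have lt_total a b : a != b -> ltn a b || ltn b a by rewrite /=; lia.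
have gt_total a b : a != b -> gtn a b || gtn b a by rewrite /=; lia.
have ltn_irr : irreflexive ltn by move=> x /=; rewrite ltnn.
have gtn_irr : irreflexive gtn by move=> x /=; rewrite ltnn.
have uV : uniq V := sorted_uniq ltn_trans ltn_irr sV.
rewrite [LHS]big_seq_cond [RHS]big_seq_cond.
have szm m : m \in masks (size V) -> size m = size V by rewrite mem_masks => /eqP.
apply: eq_big => m.
  case mV: (m \in _) => //=; have sm := szm _ mV.
  (* A mask that selects nothing has [lo m = size V], so the numerical condition excludes it too. *)
  case: (boolP (has id m)) => hm /=; last first.
    by symmetry; apply/negbTE; move: hm; rewrite has_find sm; lia.
  rewrite last_mask //.
  have := head_mask_lt _ 0 ltn_trans ltn_irr lt_total m V mx sV sm hm mxV => /= ->.
  have := head_mask_lt _ 0 gtn_trans gtn_irr gt_total (rev m) (rev V) mn sR _ _ _ => /= ->;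
    rewrite ?size_rev ?has_rev ?mem_rev //.
  by rewrite count_rev.
case/andP=> mV /and3P[hm _ _]; have sm := szm _ mV.
have sN : size (map negb m) = size V by rewrite size_map.
have disj y : y \in mask m V -> y \notin mask (map negb m) V.
  rewrite !in_mask //; case/andP=> yV hy; rewrite yV /= (nth_map false) ?hy //.
  by rewrite sm index_mem.
have hdm : head 0 (mask m V) \in mask m V.
  have : size (mask m V) != 0 by rewrite size_mask // -lt0n -has_count.
  by case: (mask m V) => //= z s; rewrite inE eqxx.
have ltm : last 0 (mask m V) \in mask m V.
  by case: (mask m V) hdm => //= z s _; exact: mem_last.
rewrite IH ?disj ?sorted_mask_ltn // size_mask // count_map.
have := count_lt_head_mask _ 0 ltn_trans ltn_irr m V sV sm hm => /= ->.
have := count_lt_head_mask _ 0 gtn_trans gtn_irr (rev m) (rev V) sR _ _ => /=.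
rewrite !size_rev has_rev map_rev -!rev_mask ?size_map // count_rev head_rev.
by move=> -> //; congr arrangements_fuel.
Qed.

Lemma mask_eq_map (V : seq nat) (m : bitseq) : uniq V -> size m = size V ->
  m = [seq x \in mask m V | x <- V].
Proof.
move=> uV sm; apply: (@eq_from_nth _ false) => [|i im]; first by rewrite size_map.
have iV : i < size V by rewrite -sm.
by rewrite (nth_map 0) // in_mask // mem_nth // index_uniq.
Qed.

Lemma uniq_blocks k V mn mx : sorted ltn V -> uniq (blocks k V mn mx).
Proof.
elim: k V mn mx => //= k IH V mn mx sV.
have uV : uniq V by apply: sorted_uniq sV; [exact: ltn_trans|move=> x /=; rewrite ltnn].
rewrite cat_uniq; apply/and3P; split.
- by case: (size V == 0).
- apply/hasPn => bs /allpairsPdep[m [cs [_ _ ->]]].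
  by case: (size V == 0).
- apply: allpairs_uniq_dep.
  + by rewrite filter_uniq ?uniq_masks.
  + by move=> m _; exact/IH/sorted_mask_ltn.
  + move=> p p' /allpairsPdep[m [bs [+ _ ->]]] /allpairsPdep[m' [bs' [+ _ ->]]].
    rewrite !mem_filter !mem_masks => /andP[_ /eqP sm] /andP[_ /eqP sm'] /= [e ->].
    by rewrite (mask_eq_map _ _ uV sm) e -mask_eq_map.
Qed.

Lemma mask_neq_nil (T : eqType) (m : bitseq) (V : seq T) : size m = size V ->
  (mask m V != [::]) = has id m.
Proof. by move=> sm; rewrite -size_eq0 size_mask // -lt0n -has_count. Qed.

Lemma size_mask_negb (T : Type) (m : bitseq) (V : seq T) : size m = size V ->
  size (mask (map negb m) V) = cn m.
Proof. by move=> sm; rewrite size_mask ?size_map // count_map; apply: eq_count. Qed.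

Lemma cn_lt (m : bitseq) : has id m -> cn m < size m.
Proof. by rewrite has_count -(count_predC id m) => h; rewrite -[X in X < _]add0n ltn_add2r. Qed.

Lemma mem_blocks k V mn mx bs : sorted ltn V -> size V < k ->
  (bs \in blocks k V mn mx) =
  [&& asc_blocks bs, overlap mn mx bs & perm_eq (flatten bs) V].
Proof.
elim: k V mn mx bs => //= k IH V mn mx bs sV sk.
have uV : uniq V by apply: sorted_uniq sV; [exact: ltn_trans|move=> x /=; rewrite ltnn].
have split (m : bitseq) : size m = size V -> perm_eq (mask m V ++ mask (map negb m) V) V.
  move=> sm; rewrite {2}(mask_eq_map _ _ uV sm) -map_comp -{1}filter_mask.
  rewrite {1}(mask_eq_map _ _ uV sm) -filter_mask.
  exact/permPl/perm_filterC.
apply/idP/and3P.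
- rewrite mem_cat => /orP[|].
    rewrite mem_nseq lt0b => /andP[/nilP ->] /eqP ->.
    by split.
  case/allpairsPdep=> m [cs [mm + ->]].
  move: mm; rewrite mem_filter mem_masks => /andP[/and3P[hm h1 h2] /eqP sm].
  rewrite IH ?sorted_mask_ltn //; last first.
    by rewrite size_mask_negb //; apply: leq_trans (cn_lt _ hm) _; rewrite sm.
  case/and3P=> a o p; split.
  + rewrite /= -/(asc_blocks _) a sorted_mask_ltn // !andbT.
    by rewrite mask_neq_nil.
  + by rewrite /= h1 h2.
  + by rewrite /= -(permPr (split m sm)) perm_cat2l.
- case: bs => [[_ _]|B bs [+ +]].
    by rewrite perm_sym => /perm_nilP ->; rewrite mem_cat mem_nseq.
  case/andP=> /andP[B0 sB] a /= /and3P[h1 h2 o] p.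
  set m := [seq x \in B | x <- V].
  have BV : {subset B <= V} by move=> x xB; rewrite -(perm_mem p) mem_cat xB.
  have eB : mask m V = B.
    rewrite -filter_mask; apply: (irr_sorted_eq ltn_trans) => //.
    + by move=> x /=; rewrite ltnn.
    + exact: (subseq_sorted ltn_trans (filter_subseq _ _)).
    + by move=> x; rewrite mem_filter; apply: andb_idr => /BV.
  have sm : size m = size V by rewrite size_map.
  rewrite mem_cat; apply/orP; right; apply/allpairsPdep; exists m, bs.
  rewrite eB; split=> //.
    rewrite mem_filter eB h1 h2 mem_masks sm eqxx !andbT.
    by rewrite -(mask_neq_nil _ _ V) // eB.
  rewrite IH ?sorted_mask_ltn ?a ?o //=.
    have := split m sm; rewrite eB perm_sym => q; rewrite -(perm_cat2l B) (permPl p) q andbT; exact: a.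
  rewrite (size_mask_negb _ m V sm); apply: leq_trans (cn_lt m _) _; last by rewrite sm.
  by rewrite -(mask_neq_nil _ _ V) // eB.
Qed.

Lemma word_perm n (s : 'S_n) : perm_eq (word s) (iota 1 n).
Proof.
have -> : word s = map (fun i : 'I_n => i.+1) (map s (enum 'I_n)) by rewrite -map_comp.
have -> : iota 1 n = map (fun i : 'I_n => i.+1) (enum 'I_n).
  by rewrite (iotaDl 1 0) -val_enum_ord -map_comp.
apply: perm_map; apply: uniq_perm; rewrite ?(map_inj_uniq perm_inj) ?enum_uniq //.
by move=> i; rewrite mem_enum inE; apply/mapP; exists (s^-1%g i); rewrite ?mem_enum ?permKV.
Qed.

Lemma word_inj n : injective (@word n).
Proof.
move=> s t /eq_in_map e; apply/permP => i; apply/val_inj.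
by have /(_ i) := e; rewrite mem_enum => /(_ isT) [].
Qed.

Lemma word_surj n v : perm_eq v (iota 1 n) -> exists t : 'S_n, word t = v.
Proof.
move=> p; have sz : size v = n by rewrite (perm_size p) size_iota.
have uv : uniq v by rewrite (perm_uniq p) iota_uniq.
have bnd (i : 'I_n) : 0 < nth 0 v i <= n.
  by have := mem_nth 0 (n := i) (s := v); rewrite sz ltn_ord => /(_ isT);
     rewrite (perm_mem p) mem_iota add1n ltnS.
pose f (i : 'I_n) := insubd i (nth 0 v i).-1.
have fE i : f i = (nth 0 v i).-1 :> nat by rewrite val_insubd; have := bnd i; case: ifP; lia.
have f_inj : injective f.
  move=> i j /(congr1 val) /=; rewrite !fE => e; apply/val_inj/eqP => /=.
  rewrite -(nth_uniq 0 _ _ uv) ?sz //; apply/eqP.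
  by move: e (bnd i) (bnd j) => /=; lia.
exists (perm f_inj); apply: (@eq_from_nth _ 0) => [|i].
  by rewrite size_map size_enum_ord sz.
rewrite size_map size_enum_ord => ltin.
rewrite (nth_map (Ordinal ltin)) ?size_enum_ord // permE fE nth_enum_ord //.
by have := bnd (Ordinal ltin) => /=; lia.
Qed.

Lemma pop_stackedP n (s : 'S_n) :
  pop_stacked s = (word s \in map flatten (blocks n.+1 (iota 1 n) 0 n.+1)).
Proof.
have si : sorted ltn (iota 1 n) by exact: iota_ltn_sorted.
apply/existsP/mapP => [[t /eqP ->]|[bs]].
  have pt := word_perm _ t.
  have [||bs [a o e]] := overlap_of_pop_stack n (word t).
  - by rewrite (perm_uniq pt) iota_uniq.
  - by rewrite (perm_all _ pt); apply/allP => x; rewrite mem_iota; lia.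
  exists bs; rewrite ?e // mem_blocks ?size_iota // a o e /=.
  by rewrite (permPl (pop_stack_perm _)).
rewrite mem_blocks ?size_iota // => /and3P[a o p] e.
have [|t et] := word_surj n (flatten (map rev bs)).
  apply: perm_trans p; elim: (bs) => //= B cs IH.
  by apply: perm_cat => //; rewrite perm_rev.
by exists t; rewrite et (pop_stack_overlap _ _ _ a o) e.
Qed.

Theorem num_pop_stackedE n : num_pop_stacked n = arrangements n 0 0.
Proof.
have si : sorted ltn (iota 1 n) by exact: iota_ltn_sorted.
have -> : arrangements n 0 0 = size (blocks n.+1 (iota 1 n) 0 n.+1).
  rewrite size_blocks // ?mem_iota ?size_iota ?ltnn ?andbF //.
  rewrite /arrangements; congr arrangements_fuel; symmetry; apply/eqP.
    by rewrite -leqn0 leqNgt -has_count; apply/hasPn => x.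
  rewrite -leqn0 leqNgt -has_count; apply/hasPn => x.
  by rewrite mem_iota; lia.
rewrite -(size_map flatten) /num_pop_stacked cardsE cardE -(size_map (@word n)).
apply: perm_size; apply: uniq_perm.
- by rewrite (map_inj_uniq (@word_inj n)) enum_uniq.
- rewrite map_inj_in_uniq ?uniq_blocks // => bs cs.
  rewrite !mem_blocks ?size_iota // => /and3P[a o _] /and3P[a' o' _].
  exact: flatten_overlap_inj a o a' o'.
move=> w; apply/mapP/idP => [[s + ->]|].
  by rewrite mem_enum -pop_stackedP.
move=> wb; have /mapP[bs] := wb; rewrite mem_blocks ?size_iota // => /and3P[_ _ p] e.
have [|s es] := word_surj n w; first by rewrite e.
by exists s; rewrite // mem_enum; move: wb; rewrite -es -pop_stackedP.
Qed.

(** * The recurrence for the first run *)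

Lemma sum_masks_cons n (F : seq bool -> nat) (P : pred (seq bool)) :
  \sum_(m <- masks n.+1 | P m) F m =
  \sum_(m <- masks n | P (true :: m)) F (true :: m) +
  \sum_(m <- masks n | P (false :: m)) F (false :: m).
Proof. by rewrite [masks n.+1]/(_ ++ _) big_cat !big_map. Qed.

Lemma sum_masks_rev n (F : seq bool -> nat) (P : pred (seq bool)) :
  \sum_(m <- masks n | P m) F m = \sum_(m <- masks n | P (rev m)) F (rev m).
Proof.
rewrite -(big_map rev P); apply: perm_big; apply: uniq_perm.
- exact: uniq_masks.
- by rewrite map_inj_uniq ?uniq_masks //; exact: (can_inj revK).
- move=> m; rewrite -{2}(revK m) mem_map; last exact: (can_inj revK).
  by rewrite !mem_masks size_rev.
Qed.

Lemma sum_masks_rcons n (F : seq bool -> nat) :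
  \sum_(m <- masks n.+1) F m =
  \sum_(m <- masks n) F (rcons m true) + \sum_(m <- masks n) F (rcons m false).
Proof.
rewrite (sum_masks_rev n.+1) sum_masks_cons.
by congr (_ + _); rewrite sum_masks_rev; apply: eq_bigr => m _; rewrite rev_cons revK.
Qed.

Lemma sum_masks_lo k j (F : seq bool -> nat) :
  \sum_(m <- masks (k + j).+1 | lo m == k) F m =
  \sum_(m <- masks j) F (nseq k false ++ true :: m).
Proof.
elim: k F => [|k IH] F.
  by rewrite sum_masks_cons /= [X in _ + X]big_pred0 ?addn0 //.
rewrite sum_masks_cons /= big_pred0 // add0n.
by rewrite -(IH (fun m => F (false :: m))); apply: eq_bigl => m; rewrite eqSS.
Qed.

Lemma sum_masks_za i j (F : seq bool -> nat) :
  \sum_(m <- masks (i + j).+1 | za m == j) F m =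
  \sum_(m <- masks i) F (rcons m true ++ nseq j false).
Proof.
rewrite addnC sum_masks_rev.
rewrite (eq_bigl (fun m => lo m == j)) => [|m]; last by rewrite revK.
rewrite (sum_masks_lo _ _ (fun m => F (rev m))) sum_masks_rev.
apply: eq_bigr => m _; rewrite rev_cat rev_cons revK; congr (F (_ ++ _)).
exact: rev_nseq.
Qed.

Lemma sum_all_false n : \sum_(m <- masks n) ~~ has id m = 1.
Proof.
elim: n => [|n IH]; first by rewrite /masks big_seq1.
by rewrite sum_masks_cons /= IH big1.
Qed.

Lemma arrangements_fuelE k k' n a c : n < k -> n < k' -> arrangements_fuel k n a c = arrangements_fuel k' n a c.
Proof.
elim: k k' n a c => //= k IH [|k'] n a c //= h h'; congr (_ + _).
rewrite big_seq_cond [RHS]big_seq_cond; apply: eq_bigr => m.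
rewrite mem_masks => /andP[/eqP sm /andP[h1 _]].
have hm : has id m by rewrite has_find sm; lia.
have := cn_lt _ hm; rewrite sm => h2.
by apply: IH; lia.
Qed.

Lemma arrangementsE n a c : arrangements n a c = (n == 0) +
  \sum_(m <- masks n | (lo m + c < n) && (za m + a < n)) arrangements (cn m) (lo m) (za m).
Proof.
rewrite {1}/arrangements /=; congr (_ + _).
rewrite big_seq_cond [RHS]big_seq_cond; apply: eq_bigr => m.
rewrite mem_masks => /andP[/eqP sm /andP[h1 _]].
have hm : has id m by rewrite has_find sm; lia.
have := cn_lt _ hm; rewrite sm => h2.
by apply: arrangements_fuelE; lia.
Qed.

Lemma arrangements_sym n a c : arrangements n a c = arrangements n c a.
Proof.
elim/ltn_ind: n a c => n IH a c; rewrite !arrangementsE; congr (_ + _).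
rewrite sum_masks_rev.
rewrite (eq_bigl (fun m => (lo m + a < n) && (za m + c < n))); last first.
  by move=> m; rewrite revK andbC.
rewrite big_seq_cond [RHS]big_seq_cond; apply: eq_bigr => m.
rewrite mem_masks => /andP[/eqP sm /andP[h1 _]].
have hm : has id m by rewrite has_find sm; lia.
rewrite count_rev revK; apply: IH.
by rewrite -sm; exact: cn_lt.
Qed.

(* The completions of a permutation whose first run is selected by [m]. *)
Definition rest (m : seq bool) := arrangements (cn m) (lo m) (za m).

Lemma rest_rev m : rest (rev m) = rest m.
Proof. by rewrite /rest count_rev revK arrangements_sym. Qed.

(* The number of permutations of [i + j + 1] values with overlapping runs
   whose first run has its maximum above exactly [i] values. *)
Definition first_max i j := \sum_(m <- masks i) rest (rcons m true ++ nseq j false).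

(** Reversing the order of the values turns the condition on the maximum of the first run into one
    on its minimum. *)
Lemma first_max_rev i j :
  first_max i j = \sum_(m <- masks i) rest (nseq j false ++ true :: m).
Proof.
rewrite /first_max -sum_masks_za -sum_masks_lo addnC sum_masks_rev.
by apply: eq_big => m; rewrite ?revK // rest_rev.
Qed.

Lemma lo_za (m : seq bool) n : size m = n -> lo m + za m < n \/ (lo m = n /\ za m = n).
Proof.
move=> sm; case: (boolP (has id m)) => hm; last first.
  by right; rewrite !hasNfind ?has_rev ?size_rev.
left; rewrite -sm => {n sm}.
elim: m hm => //= b m IH; rewrite rev_cons -cats1 find_cat has_rev size_rev.
case: b => /= [_|hm]; last by rewrite hm; have := IH hm; lia.
by case: ifP => [|_]; rewrite ?addn0 //= -has_rev has_find size_rev; lia.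
Qed.

(* The masks counted only on the left are those with [lo m = k]. *)
Lemma arrangements_step k j l : l <= k ->
  arrangements (k + j).+1 l j = arrangements (k + j).+1 l j.+1 + first_max j k.
Proof.
move=> lk; rewrite first_max_rev -sum_masks_lo !arrangementsE !add0n.
rewrite [LHS]big_mkcond [X in _ = X + _]big_mkcond [X in _ = _ + X]big_mkcond -big_split /=.
apply: eq_big_seq => m; rewrite mem_masks => /eqP /lo_za h; rewrite -/(rest m).
case: ifP; case: ifP; case: ifP; lia.
Qed.

(** Both sides sum [rest m] over the masks with [lo m <= i] and [za m <= j]: the left splits off
    [za m = j], the right [lo m = i]. *)
Lemma arrangements_step_false i j :
  arrangements (i + j).+1 i.+1 j + first_max i j = arrangements (i + j).+1 i j.+1 + first_max j i.
Proof.
rewrite [first_max j i]first_max_rev -sum_masks_lo /first_max -sum_masks_za !arrangementsE !add0n.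
rewrite [X in X + _ = _]big_mkcond [X in _ + X = _]big_mkcond.
rewrite [X in _ = X + _]big_mkcond [X in _ = _ + X]big_mkcond -!big_split /=.
apply: eq_big_seq => m; rewrite mem_masks => /eqP /lo_za h; rewrite -/(rest m).
case: ifP; case: ifP; case: ifP; case: ifP; lia.
Qed.

Lemma first_maxE i j : first_max i j =
  \sum_(m <- masks i) arrangements (cn m + j) (lo (rcons m true)) j.
Proof.
apply: eq_bigr => m _; rewrite /rest; congr arrangements.
- by rewrite count_cat -cats1 count_cat count_nseq /= mul1n !addn0.
- by rewrite find_cat has_rcons.
- rewrite rev_cat rev_rcons find_cat /=.
  by rewrite has_rev has_nseq andbF size_rev size_nseq addn0.
Qed.

Lemma first_max0 j : first_max 0 j = (j == 0).
Proof.
rewrite first_maxE /masks big_seq1 /= add0n arrangementsE big_pred0 ?addn0 // => m.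
by rewrite -{2}[j]add0n ltn_add2r ltn0.
Qed.

(* If the first run skips the value just below its maximum, exchange the two: the
   overlap conditions change only when the second run starts at that value, which
   gives the sum, or when the first run is a single letter, which compensates for
   the first runs that do not skip. *)
Lemma first_maxS i j : first_max i.+1 j =
  first_max i j.+1 + \sum_(m <- masks i) first_max j (cn m).
Proof.
have lo_le (m : seq bool) : lo m <= cn m by elim: m => //= [[]].
apply: (@addIn (first_max i j)).
(* The added term is attached to the mask that selects nothing, the one mask where
   [arrangements_step_false] replaces [arrangements_step]. *)
have {1}-> : first_max i j = \sum_(m <- masks i) ~~ has id m * first_max i j.
  by rewrite -big_distrl /= sum_all_false mul1n.
rewrite [first_max i.+1 j]first_maxE sum_masks_rcons -addnA -big_split addnC /=.
rewrite [first_max i j in RHS]first_maxE [first_max i j.+1]first_maxE; congr (_ + _).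
  rewrite -big_split /=; rewrite big_seq [RHS]big_seq; apply: eq_bigr => m.
  rewrite mem_masks => /eqP sm.
  rewrite -!cats1 -catA !find_cat !count_cat /= addn1 addn0 addnS addSn.
  case: (boolP (has id m)) => hm; rewrite ?addn0 ?mul0n ?addn0 ?mul1n.
    by rewrite addnS; apply: arrangements_step; exact: lo_le.
  have -> : cn m = i by rewrite -sm; elim: (m) hm => //= [[]] s // IH /IH ->.
  by rewrite sm addnS arrangements_step_false.
(* When the value just below the maximum is selected too, dropping one of the two changes no count
   of rejected values. *)
apply: eq_bigr => m _; congr arrangements; last by rewrite -!cats1 -catA !find_cat; case: ifP.
by rewrite -cats1 count_cat /= !addn0.
Qed.

Lemma arrangements_first_max n : arrangements n.+1 0 0 = \sum_(j < n.+1) first_max (n - j) j.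
Proof.
rewrite arrangementsE add0n.
rewrite (eq_bigr (fun j : 'I_n.+1 => \sum_(m <- masks n.+1 | za m == j) rest m)); last first.
  by move=> j _; rewrite /first_max -sum_masks_za subnK // -ltnS.
rewrite (exchange_big_dep predT) //= big_mkcond /=.
apply: eq_big_seq => m; rewrite mem_masks => /eqP /lo_za h; rewrite !addn0 -/(rest m).
under eq_bigl do rewrite eq_sym.
rewrite (big_ord1_eq _ (fun _ => rest m)).
case: ifP; case: ifP; lia.
Qed.

Set Implicit Arguments.
Unset Strict Implicit.
Unset Printing Implicit Defensive.

Import GRing.Theory Num.Theory.
Local Open Scope ring_scope.

(** * Exponential generating functions *)

(* Exponential generating functions: [f] stands for the sum of
   [f n * x ^ n / n!], so that differentiation is a shift of the sequence. *)
Definition hseries (K : Type) := nat -> K.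

Section HurwitzRing.

Variable K : comNzRingType.

HB.instance Definition _ := gen_eqMixin (hseries K).
HB.instance Definition _ := gen_choiceMixin (hseries K).

Implicit Types f g h : hseries K.

Definition hderiv f : hseries K := fun n => f n.+1.

(** The binomial convolution, encoded by the Leibniz rule: [hderivM] holds by computation, and the
    ring axioms follow by induction without binomial coefficients. *)
Fixpoint hmul_coef f g n {struct n} : K :=
  if n is n'.+1 then hmul_coef (hderiv f) g n' + hmul_coef f (hderiv g) n'
  else f 0%N * g 0%N.

Definition hmul f g : hseries K := hmul_coef f g.
Definition hadd f g : hseries K := fun n => f n + g n.
Definition hopp f : hseries K := fun n => - f n.
Definition hconst (c : K) : hseries K := fun n => if n is 0 then c else 0.

Fact haddA : associative hadd.
Proof. by move=> f g h; apply/funext => n; exact: addrA. Qed.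
Fact haddC : commutative hadd.
Proof. by move=> f g; apply/funext => n; exact: addrC. Qed.
Fact hadd0 : left_id (hconst 0) hadd.
Proof. by move=> f; apply/funext => -[|n]; exact: add0r. Qed.
Fact haddN : left_inverse (hconst 0) hopp hadd.
Proof. by move=> f; apply/funext => -[|n]; exact: addNr. Qed.

HB.instance Definition _ := GRing.isZmodule.Build (hseries K) haddA haddC hadd0 haddN.

Fact hmulC : commutative hmul.
Proof.
move=> f g; apply/funext => n; rewrite /hmul.
elim: n f g => [|n IH] f g /=; first exact: mulrC.
by rewrite addrC (IH f) (IH _ g).
Qed.

Fact hmulDl : left_distributive hmul hadd.
Proof.
move=> f g h; apply/funext => n; rewrite /hmul /hadd.
elim: n f g h => [|n IH] f g h /=; first exact: mulrDl.
by rewrite (IH f g) -[hderiv _]/(hadd (hderiv f) (hderiv g)) IH addrACA.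
Qed.

Fact hmulA : associative hmul.
Proof.
move=> f g h; apply/funext => n; rewrite /hmul.
elim: n f g h => [|n IH] f g h; first exact: mulrA.
have DM f1 g1 : hderiv (hmul_coef f1 g1) =
    hadd (hmul_coef (hderiv f1) g1) (hmul_coef f1 (hderiv g1)) by [].
rewrite [LHS]/= [RHS]/= DM [in RHS]DM.
have Dl f1 f2 f3 k : hmul_coef (hadd f1 f2) f3 k = hmul_coef f1 f3 k + hmul_coef f2 f3 k.
  by rewrite -[LHS]/(hmul _ _ k) hmulDl.
have Dr f1 f2 f3 k : hmul_coef f3 (hadd f1 f2) k = hmul_coef f3 f1 k + hmul_coef f3 f2 k.
  by rewrite -[LHS]/(hmul _ _ k) hmulC hmulDl ![hmul _ f3]hmulC.
by rewrite Dl Dr !IH addrA.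
Qed.

Fact hmul1 : left_id (hconst 1) hmul.
Proof.
have h0 f n : hmul_coef (hconst 0) f n = 0.
  elim: n f => [|n IH] f /=; first exact: mul0r.
  by rewrite (_ : hderiv _ = hconst 0) ?IH ?addr0 //; apply/funext => -[].
move=> f; apply/funext => n; rewrite /hmul.
elim: n f => [|n IH] f /=; first exact: mul1r.
rewrite IH (_ : hderiv (hconst 1) = hconst 0) ?h0 ?add0r //.
by apply/funext => -[].
Qed.

Fact hone_neq0 : hconst 1 != 0.
Proof. by apply/eqP => /(congr1 (fun f : hseries K => f 0%N)) /eqP; rewrite oner_eq0. Qed.

HB.instance Definition _ := GRing.Zmodule_isComNzRing.Build (hseries K)
  hmulA hmulC hmul1 hmulDl hone_neq0.

Lemma hderivM f g : hderiv (f * g) = hderiv f * g + f * hderiv g.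
Proof. by []. Qed.

Fact hderiv_is_zmod_morphism : zmod_morphism hderiv.
Proof. by []. Qed.

HB.instance Definition _ := GRing.isZmodMorphism.Build (hseries K) (hseries K)
  hderiv hderiv_is_zmod_morphism.

Lemma haddE f g n : (f + g) n = f n + g n. Proof. by []. Qed.
Lemma hoppE f n : (- f) n = - f n. Proof. by []. Qed.
Lemma hmul0E f g : (f * g) 0%N = f 0%N * g 0%N. Proof. by []. Qed.
Lemma hmulSE f g n : (f * g) n.+1 = (hderiv f * g) n + (f * hderiv g) n.
Proof. by []. Qed.
Lemma hzeroE n : (0 : hseries K) n = 0. Proof. by case: n. Qed.
Lemma hderivE f n : hderiv f n = f n.+1. Proof. by []. Qed.

Lemma hderiv_const c : hderiv (hconst c) = 0.
Proof. by apply/funext => n; rewrite hzeroE. Qed.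

Lemma hderiv1 : hderiv 1 = 0.
Proof. exact: hderiv_const. Qed.

Fact hconst_is_zmod_morphism : zmod_morphism hconst.
Proof. by move=> a b; apply/funext => -[|n] //=; rewrite haddE hoppE /= subr0. Qed.

Fact hconst_is_monoid_morphism : monoid_morphism hconst.
Proof.
split=> // a b; apply/funext => -[|n] //.
by rewrite hmulSE !hderiv_const mul0r mulr0 hzeroE addr0.
Qed.

HB.instance Definition _ := GRing.isZmodMorphism.Build K (hseries K)
  hconst hconst_is_zmod_morphism.
HB.instance Definition _ := GRing.isMonoidMorphism.Build K (hseries K)
  hconst hconst_is_monoid_morphism.

Lemma hmul_low f g n : (forall k, (k < n)%N -> g k = 0) -> (f * g) n = f 0%N * g n.
Proof.
elim: n f g => // n IH f g g0.
rewrite hmulSE IH => [|k kn]; last by rewrite g0 // ltnW.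
by rewrite g0 // mulr0 add0r IH // => k kn; rewrite hderivE g0.
Qed.

(** Coefficient [n.+1] of [u] is a combination of the coefficients up to [n]. Identities between
    series are proved by applying this to a difference. *)
Lemma hode_uniq a u : hderiv u = a * u -> u 0%N = 0 -> u = 0.
Proof.
move=> Du u0; apply/funext => n; rewrite hzeroE.
elim/ltn_ind: n => -[//|n] IH.
rewrite -hderivE Du hmul_low ?IH ?mulr0 // => k kn; exact/IH/ltnW.
Qed.

End HurwitzRing.

Lemma hreg (K : idomainType) (f g : hseries K) : f 0%N != 0 -> f * g = 0 -> g = 0.
Proof.
move=> f0 fg; apply/funext => n; rewrite hzeroE.
elim/ltn_ind: n => n IH.
have : (f * g) n = 0 by rewrite fg hzeroE.
by rewrite hmul_low // => /eqP; rewrite mulf_eq0 (negPf f0) => /eqP.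
Qed.

(** * Formal Taylor series and exponentials *)

Section Characteristics.

Variable K : comNzRingType.

Local Notation S := (hseries K).

Definition hexp : S := fun _ => 1.
Definition htau : S := fun n => (n == 1)%:R.

Lemma hderiv_exp : hderiv hexp = hexp. Proof. by []. Qed.
Lemma hderiv_tau : hderiv htau = 1.
Proof. by apply/funext => -[]. Qed.

Lemma hmul_tau (f : S) n : (htau * f) n = f n.-1 *+ n.
Proof.
elim: n f => [|n IH] f; first by rewrite hmul0E mul0r.
by rewrite hmulSE hderiv_tau mul1r IH mulrS hderivE /=; case: n {IH}.
Qed.

(** Coefficient [n.+1] is coefficient [n] of the termwise derivative, in which either [tau ^ k / k!]
    or [c k] is differentiated; no infinite sum is formed. *)
Definition taylor_coef (c : nat -> S) := fix F (c : nat -> S) n {struct n} : K :=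
  if n is n'.+1 then F (fun k => c k.+1) n' + F (fun k => hderiv (c k)) n'
  else c 0%N 0%N.

(* The formal series of [tau ^ k / k! * c k]. *)
Definition taylor (c : nat -> S) : S := taylor_coef c c.

Lemma taylor0 c : taylor c 0%N = c 0%N 0%N. Proof. by []. Qed.

Lemma hderiv_taylor c : hderiv (taylor c) =
  taylor (fun k => c k.+1) + taylor (fun k => hderiv (c k)).
Proof. by []. Qed.

Lemma taylorS c n : taylor c n.+1 =
  taylor (fun k => c k.+1) n + taylor (fun k => hderiv (c k)) n.
Proof. by []. Qed.

Lemma taylorD c c' : taylor (fun k => c k + c' k) = taylor c + taylor c'.
Proof.
apply/funext => n; elim: n c c' => // n IH c c'.
transitivity ((taylor (fun k => c k.+1) + taylor (fun k => c' k.+1)) n +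
    (taylor (fun k => hderiv (c k)) + taylor (fun k => hderiv (c' k))) n).
  by rewrite -!IH.
exact: addrACA.
Qed.

Lemma taylorZ u c : taylor (fun k => u * c k) = u * taylor c.
Proof.
apply/funext => n; elim: n u c => // n IH u c.
rewrite hmulSE hderiv_taylor mulrDr haddE -!IH taylorS addrCA; congr (_ + _).
rewrite -haddE -taylorD; congr (taylor _ n); apply/funext => k.
Qed.

Lemma taylor_tau c : taylor (fun k => c k.-1 *+ k) = htau * taylor c.
Proof.
apply/funext => n; elim: n c => [|n IH] c.
  by rewrite hmul0E mul0r taylor0.
rewrite taylorS hmulSE hderiv_tau mul1r hderiv_taylor mulrDr haddE -!IH.
rewrite addrA; congr (_ + taylor _ n); last by apply/funext => k; rewrite raddfMn.
rewrite -haddE -taylorD; congr (taylor _ n); apply/funext => k.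
by rewrite mulrS /=; case: k.
Qed.

(** This is [exp (tau * l)], where [l] is itself a series in [tau]. *)
Definition texp (l : S) : S := taylor (fun k => l ^+ k).

Lemma texp0 l : texp l 0%N = 1. Proof. by []. Qed.

Lemma hderivX (l : S) k : hderiv (l ^+ k) = hderiv l * (l ^+ k.-1 *+ k).
Proof.
elim: k => [|k IH]; first by rewrite expr0 hderiv1 mulr0.
rewrite exprS hderivM IH mulrS mulrDr mulrCA; congr (_ + _ * _).
by case: k {IH} => [|k]; rewrite ?mulr0 //= mulrnAr exprS.
Qed.

Lemma hderiv_texp l : hderiv (texp l) = hderiv (htau * l) * texp l.
Proof.
rewrite hderiv_taylor hderivM hderiv_tau mul1r mulrDl; congr (_ + _).
  rewrite -taylorZ; congr taylor; apply/funext => k; exact: exprS.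
rewrite mulrAC -[htau * _]taylor_tau; under [in LHS]eq_fun do rewrite hderivX.
by rewrite taylorZ mulrC.
Qed.

End Characteristics.

(** * Equations on two-variable series *)

Section Arrays.

Variable K : comNzRingType.

Local Notation S := (hseries K).
Local Notation q := (hexp K).

(* [h i j] is the coefficient of [x ^ i / i! * y ^ j / j!]; [diff] is
   [d/dx - d/dy], which annihilates the functions of [x + y]. *)
Definition array := nat -> S.

Implicit Types h : array.

Definition diff h : array := fun i j => h i.+1 j - h i j.+1.
Definition dy h : array := fun i => hderiv (h i).
Definition expx h : array := fun i j => (q * (fun i' => h i' j : K) : S) i.
Definition expy h : array := fun i => q * h i.
Definition column h : S := fun i => h i 0%N.
Definition swap h : array := fun i j => h j i.
Definition asub h h' : array := fun i => h i - h' i.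

Lemma diff_asub h h' : diff (asub h h') = asub (diff h) (diff h').
Proof.
apply/funext => i; apply/funext => j.
by rewrite /diff /asub !haddE !hoppE; ring.
Qed.

Lemma expxS h i j : expx h i.+1 j = expx h i j + expx (fun i' => h i'.+1) i j.
Proof. by []. Qed.

Lemma expx_asub h h' : expx (asub h h') = asub (expx h) (expx h').
Proof.
apply/funext => i; apply/funext => j.
by rewrite /asub haddE hoppE /expx -hoppE -haddE -mulrBr.
Qed.

Lemma expy_asub h h' : expy (asub h h') = asub (expy h) (expy h').
Proof. by apply/funext => i; rewrite /expy /asub mulrBr. Qed.

Lemma diff_expx h i : diff (expx h) i = expx h i + expx (diff h) i.
Proof.
apply/funext => j; rewrite haddE /diff expxS -addrA; congr (_ + _).
rewrite /expx -hoppE -haddE -mulrBr; congr ((_ * _ : S) i).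
Qed.

Lemma diff_expxy h : diff (expx (expy h)) = expx (expy (diff h)).
Proof.
apply/funext => i; apply/funext => j.
rewrite /diff expxS.
have -> : (fun i => (fun j => h i.+1 j - h i j.+1) : S) =
    asub (fun i => h i.+1) (dy h).
  by apply/funext => a; apply/funext => b.
rewrite expy_asub expx_asub /asub haddE hoppE.
have -> : expx (expy h) i j.+1 = expx (expy h) i j + expx (expy (dy h)) i j.
  rewrite -haddE /expx; rewrite -[RHS]/((q * _ + q * _ : S) i) -mulrDr.
  by [].
by rewrite opprD addrACA subrr add0r.
Qed.

Lemma iter_diff_asub k h h' :
  iter k diff (asub h h') = asub (iter k diff h) (iter k diff h').
Proof. by elim: k => //= k ->; rewrite diff_asub. Qed.

Lemma iter_diff_expxy k h :
  iter k diff (expx (expy h)) = expx (expy (iter k diff h)).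
Proof. by elim: k => //= k ->; rewrite diff_expxy. Qed.

Lemma iter_diff_dy k h : iter k diff (dy h) = dy (iter k diff h).
Proof. by elim: k => //= k ->. Qed.

(** Taylor's formula along the line [x + y = tau], from [(0, tau)] to [(tau, 0)]: [diff] is the
    derivative in that direction. *)
Lemma taylor_iter_diff h : taylor (fun k => iter k diff h 0%N) = column h.
Proof.
apply/funext => n; elim: n h => // n IH h.
rewrite taylorS.
have -> : (fun k => iter k.+1 diff h 0%N) = (fun k => iter k diff (diff h) 0%N).
  by apply/funext => k; rewrite iterSr.
have -> : (fun k => hderiv (iter k diff h 0%N)) = (fun k => iter k diff (dy h) 0%N).
  by apply/funext => k; rewrite iter_diff_dy.
by rewrite !IH /column /diff /dy hderivE subrK.
Qed.

(* The integral of [h] over the segment from [(0, t)] to [(t, 0)]. *)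
Definition antidiag h : S :=
  fun n => if n is n'.+1 then \sum_(j < n'.+1) h (n' - j)%N j else 0.

(** The fundamental theorem of calculus on the segment. *)
Lemma antidiag_diff h : antidiag (diff h) = column h - h 0%N.
Proof.
apply/funext => -[|n]; rewrite haddE hoppE /column /=; first by rewrite subrr.
rewrite sumrB.
have e1 : \sum_(j < n.+2) h (n.+1 - j)%N j = h n.+1 0%N + \sum_(j < n.+1) h (n - j)%N j.+1.
  by rewrite big_ord_recl subn0.
have e2 : \sum_(j < n.+2) h (n.+1 - j)%N j = \sum_(j < n.+1) h (n - j).+1 j + h 0%N n.+1.
  rewrite big_ord_recr /= subnn; congr (_ + _).
  by apply: eq_bigr => j _; rewrite subSn // -ltnS.
apply: (canLR (addrK _)); rewrite addrAC; apply: (canRL (addrK _)).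
by rewrite -e1 -e2.
Qed.

Lemma hderiv_antidiag h :
  hderiv (antidiag h) = antidiag (fun i => h i.+1) + h 0%N.
Proof.
apply/funext => -[|n]; rewrite haddE /= hderivE /=.
  by rewrite big_ord_recl big_ord0 addr0 add0r.
rewrite big_ord_recr /= subnn; congr (_ + _).
by apply: eq_bigr => j _; rewrite subSn // -ltnS.
Qed.

Lemma antidiagD h h' : antidiag (fun i => h i + h' i) = antidiag h + antidiag h'.
Proof.
by apply/funext => -[|n]; rewrite haddE /= ?addr0 // -big_split.
Qed.

Lemma antidiag_asub h h' : antidiag (asub h h') = antidiag h - antidiag h'.
Proof.
by apply/funext => -[|n]; rewrite haddE hoppE /= ?subr0 // -sumrB.
Qed.

(** The factor [e^(x+y)] is constant on the segment. *)
Lemma antidiag_expxy h : antidiag (expx (expy h)) = q * antidiag h.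
Proof.
apply/funext => n; elim: n h => [|n IH] h; first by rewrite hmul0E mulr0.
have e0 : expx (expy h) 0%N = q * h 0%N by apply/funext => j; exact: mul1r.
have eS : (fun i => expx (expy h) i.+1) =
    (fun i => expx (expy h) i + expx (expy (fun i => h i.+1)) i).
  by apply/funext => i; apply/funext => j; rewrite haddE -expxS.
by rewrite -[LHS]hderivE hmulSE !hderiv_antidiag e0 eS antidiagD mulrDr !haddE !IH addrA.
Qed.

Definition first_max_array : array := fun i j => (first_max i j)%:R.

Local Notation H := first_max_array.

(** There are [C(n,k)] masks with [cn m = k], so the sum is the binomial convolution with the
    constant sequence 1. *)
Lemma sum_masks_exp (g : S) n : \sum_(m <- masks n) g (cn m) = (q * g) n.
Proof.
elim: n g => [|n IH] g; first by rewrite big_seq1 hmul0E mul1r.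
rewrite [masks _]/(_ ++ _) big_cat !big_map hmulSE -!IH addrC.
by rewrite addrC; congr (_ + _); apply: eq_bigr.
Qed.

Lemma diff_first_max : diff H = expx (swap H).
Proof.
apply/funext => i; apply/funext => j; rewrite /diff /H first_maxS natrD natr_sum.
by rewrite addrAC subrr add0r (sum_masks_exp (H j)).
Qed.

(** Apply [diff] to [e^x H^T]: the factor [e^x] reproduces [diff H], and exchanging [x] and [y]
    changes the sign of [diff], so [diff H^T = - e^y H]. *)
Lemma diff2_first_max : diff (diff H) = asub (diff H) (expx (expy H)).
Proof.
have ds : diff (swap H) = fun i => - expy H i.
  apply/funext => i; apply/funext => j; rewrite hoppE.
  by rewrite -[expy H i j]/(expx (swap H) j i) -diff_first_max /diff opprB.
apply/funext => i; rewrite {1}diff_first_max diff_expx ds -diff_first_max; congr (_ + _).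
apply/funext => j; rewrite [RHS]hoppE /expx -[RHS]/((- (q * _ : S)) i) -mulrN.
by congr ((_ * _ : S) i).
Qed.

Lemma first_max_row0 : H 0%N = 1.
Proof. by apply/funext => -[|j]; rewrite /H first_max0. Qed.

Lemma diff_first_max_row0 : diff H 0%N = column H.
Proof. by rewrite diff_first_max; apply/funext => j; exact: mul1r. Qed.

Lemma iter_diff_first_max k : iter k.+2 diff H 0%N =
  iter k.+1 diff H 0%N - q * iter k diff H 0%N.
Proof.
rewrite !iterSr diff2_first_max iter_diff_asub iter_diff_expxy /asub -!iterSr.
by congr (_ - _); apply/funext => j; exact: mul1r.
Qed.

Definition pop_stacked_egf : S := fun n => (num_pop_stacked n)%:R.

(** Integrate [diff2_first_max] over the segment. With [B = column H] this reads
    [q - B = (B - 1) - q * antidiag H], and the generating function is [1 + antidiag H]. *)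
Lemma pop_stacked_egfE : q * pop_stacked_egf = column H *+ 2 - 1.
Proof.
have -> : pop_stacked_egf = 1 + antidiag H.
  apply/funext => -[|n]; rewrite haddE /pop_stacked_egf num_pop_stackedE.
    by rewrite arrangementsE big_pred0 //= addr0.
  by rewrite arrangements_first_max natr_sum /= add0r.
have := antidiag_diff (diff H); rewrite diff2_first_max antidiag_asub.
rewrite antidiag_expxy antidiag_diff first_max_row0 diff_first_max_row0.
have -> : column (diff H) = q.
  apply/funext => i; rewrite diff_first_max /column /expx.
  by rewrite -[RHS]/(q i) -[q in RHS]mulr1 -first_max_row0.
move=> e; rewrite mulrDr mulr1 -(subKr (column H - 1) (q * antidiag H)) e; ring.
Qed.

End Arrays.

(** * Closed form of the generating function *)

Section ClosedForm.

Variable K : idomainType.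
Variable rho : hseries K.
Hypothesis rhoE : rho * (1 - rho) = hexp K.

Local Notation B := (column (first_max_array K)).
Local Notation E := (texp rho).

(** The iterates of [diff] on row 0 satisfy [u_(k+2) = u_(k+1) - q u_k] with [u_0 = 1], [u_1 = B];
    the characteristic roots are [rho] and [1 - rho]. Summing the Taylor series gives a linear
    equation for [B]. *)
Lemma column_first_max : B * (E + 1 - rho) = (1 - rho) * (E + rho).
Proof.
have cE k : (1 - rho *+ 2) * iter k (@diff K) (first_max_array K) 0%N =
    (1 - rho - B) * rho ^+ k + (B - rho) * (1 - rho) ^+ k.
  suff [] : (1 - rho *+ 2) * iter k (@diff K) (first_max_array K) 0%N =
      (1 - rho - B) * rho ^+ k + (B - rho) * (1 - rho) ^+ k /\
    (1 - rho *+ 2) * iter k.+1 (@diff K) (first_max_array K) 0%N =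
      (1 - rho - B) * rho ^+ k.+1 + (B - rho) * (1 - rho) ^+ k.+1 by [].
  elim: k => [|k [IH1 IH2]].
    by rewrite /= first_max_row0 diff_first_max_row0; split; ring.
  split=> //; rewrite iter_diff_first_max mulrBr IH2 mulrCA IH1 -rhoE !exprS; ring.
have := taylor_iter_diff (first_max_array K).
move/(congr1 (fun f => (1 - rho *+ 2) * f)); rewrite -taylorZ.
rewrite (_ : (fun k => _) = fun k =>
  (1 - rho - B) * rho ^+ k + (B - rho) * (1 - rho) ^+ k); last exact/funext.
rewrite taylorD !taylorZ -!/(texp _) => eB.
have EE : E * texp (1 - rho) = rho * (1 - rho).
  rewrite rhoE; apply/eqP; rewrite -subr_eq0; apply/eqP.
  apply: (@hode_uniq _ 1).
    rewrite raddfB /= hderivM !hderiv_texp !hderivM raddfB /= !hderiv_tau hderiv1 hderiv_exp; ring.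
  by rewrite haddE hoppE hmul0E !texp0 mulr1 subrr.
(* The equation for [B] is the claim multiplied by [E - rho], whose constant coefficient [1 - rho 0]
   is nonzero by [rhoE]. *)
apply/eqP; rewrite -subr_eq0; apply/eqP; apply: (@hreg _ (E - rho)).
  have : rho 0%N * (1 - rho 0%N) != 0.
    by have := congr1 (fun f : hseries K => f 0%N) rhoE; rewrite hmul0E haddE hoppE => ->; exact: oner_neq0.
  by rewrite mulf_eq0 negb_or haddE hoppE texp0 => /andP[].
have : E * ((1 - rho *+ 2) * B) = (1 - rho - B) * E ^+ 2 + (B - rho) * (rho * (1 - rho)).
  by rewrite -eB -EE; ring.
move=> e; apply/eqP; rewrite -subr_eq0 -(subrr (E * ((1 - rho *+ 2) * B))) {2}e.
apply/eqP; ring.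
Qed.

End ClosedForm.

Section Flow.

Variables (K : comNzRingType) (g : {poly K}) (x0 : K).

(* The Taylor coefficients of [p (x t)] along the solution of [x' = g x],
   [x 0 = x0]. *)
Definition flow (p : {poly K}) : hseries K :=
  fun n => (iter n (fun p => g * p^`()) p).[x0].

Lemma hderiv_flow p : hderiv (flow p) = flow (g * p^`()).
Proof. by apply/funext => n; rewrite hderivE /flow iterSr. Qed.

Lemma flowB p r : flow (p - r) = flow p - flow r.
Proof.
apply/funext => n; elim: n p r => [|n IH] p r.
  by rewrite haddE hoppE /flow /= !hornerE.
by rewrite haddE hoppE -!hderivE !hderiv_flow derivB mulrBr IH.
Qed.

Lemma flowD p r : flow (p + r) = flow p + flow r.
Proof.
apply/funext => n; elim: n p r => [|n IH] p r.
  by rewrite haddE /flow /= !hornerE.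
by rewrite haddE -!hderivE !hderiv_flow derivD mulrDr IH.
Qed.

Lemma flowM p r : flow (p * r) = flow p * flow r.
Proof.
apply/funext => n; elim: n p r => [|n IH] p r.
  by rewrite hmul0E /flow /= !hornerE.
rewrite -hderivE hderiv_flow hmulSE !hderiv_flow -!IH -haddE -flowD.
by congr (flow _ n); rewrite derivM; ring.
Qed.

End Flow.

Local Notation K := algC.

(* [rho = (1 - sqrt (1 - 4 q)) / 2], where [s = (1 - 4 q)^(-1/2)] satisfies the
   polynomial equation [s' = (s^3 - s) / 2] and hence is a flow; [s0] is a square
   root of [-1/3]. *)
Lemma exists_rho : exists rho : hseries K, rho * (1 - rho) = hexp K.
Proof.
have two0 : (2%:R : K) != 0 by rewrite pnatr_eq0.
have [s0 hs0] : exists s0 : K, s0 ^+ 2 * (1 - 4%:R) = 1.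
  by exists (sqrtC (1 - 4%:R)^-1); rewrite sqrtCK mulVf // subr_eq0 (eqr_nat _ 1 4).
pose g : {poly K} := (2%:R^-1)%:P * ('X ^+ 3 - 'X).
pose s := flow g s0 'X; pose q := hexp K.
have g2 : g *+ 2 = 'X * 'X * 'X - 'X.
  by rewrite /g -[LHS]mulr_natl mulrA -polyC_natr -polyCM mulfV // mul1r; ring.
have Ds : hderiv s *+ 2 = s * s * s - s.
  by rewrite /s hderiv_flow derivX mulr1 mulr2n -flowD -mulr2n g2 flowB !flowM.
(* The difference [y - 1] solves [u' = s^2 u], and it vanishes at 0 by the choice of [s0]. *)
pose y := s * s * (1 - q *+ 4).
have y1 : y = 1.
  apply/eqP; rewrite -subr_eq0; apply/eqP; apply: (@hode_uniq _ (s * s)).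
    have Dq : hderiv (1 - q *+ 4) = - (q *+ 4).
      by rewrite raddfB /= hderiv1 sub0r (raddfMn (@hderiv K)).
    rewrite raddfB /= hderiv1 /y !hderivM Dq.
    transitivity (hderiv s *+ 2 * s * (1 - q *+ 4) - s * s * q *+ 4); first by ring.
    by rewrite Ds; ring.
  rewrite haddE hoppE /y !hmul0E haddE hoppE /= {1 2}/s /flow /= !hornerE -expr2.
  rewrite -[X in _ * X - _]/(1 - 4%:R) hs0 subrr //.
have h2 : hconst (2%:R^-1 : K) *+ 2 = 1.
  by rewrite -raddfMn /= -[X in hconst X]mulr_natl mulfV // rmorph1.
set h := hconst _ in h2.
(* Since [y = 1], the series [s * (1 - 4 q)] is a square root of [1 - 4 q]. *)
exists (h * (1 - s * (1 - q *+ 4))).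
transitivity (h * h *+ 4 * q + h * h * (1 - s * s * (1 - q *+ 4)) * (1 - q *+ 4)
  + (1 - h *+ 2) * h * (1 - s * (1 - q *+ 4))); first by ring.
rewrite -/y y1 h2.
transitivity ((h *+ 2) * (h *+ 2) * q); first by ring.
by rewrite h2 !mul1r.
Qed.

Section PolynomialDerivation.

Variables (R : comNzRingType) (d : {additive R -> R}) (g : {poly R}).

(* The extension of the derivation [d] that maps the variable to [g]. *)
Definition dext (p : {poly R}) := map_poly d p + g * p^`().

Fact dext_is_nmod_morphism : nmod_morphism dext.
Proof.
split=> [|p r]; first by rewrite /dext raddf0 deriv0 mulr0 addr0.
by rewrite /dext raddfD derivD mulrDr addrACA.
Qed.

HB.instance Definition _ := GRing.isNmodMorphism.Build {poly R} {poly R}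
  dext dext_is_nmod_morphism.

Variables (L : comNzRingType) (phi : {rmorphism R -> hseries L}) (s Delta : hseries L).

Definition ev := horner_morph (fun x => mulrC s (phi x)).

HB.instance Definition _ := GRing.RMorphism.on ev.

Lemma evX : ev 'X = s. Proof. exact: horner_morphX. Qed.
Lemma evC c : ev c%:P = phi c. Proof. exact: horner_morphC. Qed.

(** The factor [Delta], later [1 - 2 rho], clears the denominator of [rho'], so that the derivation
    lifts to polynomials. *)
Lemma hderiv_ev p : (forall a, Delta * hderiv (phi a) = phi (d a)) ->
  Delta * hderiv s = ev g -> Delta * hderiv (ev p) = ev (dext p).
Proof.
move=> Dphi Ds; elim/poly_ind: p => [|p c IH].
  by rewrite !raddf0 mulr0.
have -> : dext (p * 'X + c%:P) = dext p * 'X + p * g + (d c)%:P.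
  rewrite /dext !raddfD /= derivM derivX derivC mulr1 addr0 map_polyC /=.
  rewrite (_ : map_poly d (p * 'X) = map_poly d p * 'X); first by ring.
  apply/polyP => i; rewrite coefMX !coef_map_id0 ?raddf0 // coefMX.
  by case: eqP; rewrite ?raddf0.
move: (dext p) IH => P IH; rewrite !rmorphD !rmorphM /= evX !evC !raddfD /= hderivM mulrDr Dphi mulrDr.
rewrite mulrA IH -Ds; ring.
Qed.

End PolynomialDerivation.

(** * Algebraic independence *)

Lemma coefM_top (R : comNzRingType) (p r : {poly R}) a b :
  (size p <= a.+1)%N -> (size r <= b.+1)%N -> (p * r)`_(a + b) = p`_a * r`_b.
Proof.
move=> pa rb; have la : (a < (a + b).+1)%N by rewrite ltnS leq_addr.
rewrite coefM (bigD1 (Ordinal la)) //= addKn big1 ?addr0 // => i; rewrite -val_eqE /= => ia.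
case: (ltngtP i a) ia => // h _.
  by rewrite [r`__]nth_default ?mulr0 //; apply: leq_trans rb _; lia.
by rewrite nth_default ?mul0r //; apply: leq_trans pa _.
Qed.

Lemma polyK_mulrn_eq0 (p : {poly K}) n : p *+ n.+1 = 0 -> p = 0.
Proof.
move=> pn; apply/polyP => i; have := congr1 (fun r : {poly K} => r`_i) pn.
by rewrite coefMn coef0 => /eqP; rewrite mulrn_eq0 => /eqP.
Qed.

Local Notation Prho := {poly K}.
Local Notation Ptau := {poly {poly K}}.
Local Notation PE := {poly {poly {poly K}}}.

(* The variables of [Prho], [Ptau] and [PE] stand for [rho], [tau] and
   [exp (tau * rho)]; [drho], [dtau] and [dE] lift [(1 - 2 rho) * d/dtau]. *)
Definition exp_rho : Prho := 'X * (1 - 'X).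
Definition disc_rho : Prho := 1 - 'X *+ 2.
Definition drho : Prho -> Prho := dext \0 exp_rho.
HB.instance Definition _ := GRing.Additive.on drho.
Definition dtau : Ptau -> Ptau := dext drho disc_rho%:P.
HB.instance Definition _ := GRing.Additive.on dtau.
(** Stands for [(1 - 2 rho)] times the logarithmic derivative of [E]. *)
Definition dlogE : Ptau := ('X * disc_rho)%:P + exp_rho *: 'X.
Definition dE : PE -> PE := dext dtau (dlogE *: 'X).
HB.instance Definition _ := GRing.Additive.on dE.

Section Independence.

Variable rho : hseries K.
Hypothesis rhoE : rho * (1 - rho) = hexp K.

Local Notation q := (hexp K).
Local Notation tau := (htau K).
Local Notation E := (texp rho).
Local Notation Delta := (1 - rho *+ 2).

Definition ev1 : Prho -> hseries K := ev (@hconst K) rho.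
HB.instance Definition _ := GRing.RMorphism.on ev1.
Definition ev2 : Ptau -> hseries K := ev ev1 tau.
HB.instance Definition _ := GRing.RMorphism.on ev2.
Definition ev3 : PE -> hseries K := ev ev2 E.
HB.instance Definition _ := GRing.RMorphism.on ev3.

Lemma ev1C c : ev1 c%:P = hconst c. Proof. exact: evC. Qed.
Lemma ev1X : ev1 'X = rho. Proof. exact: evX. Qed.
Lemma ev2C c : ev2 c%:P = ev1 c. Proof. exact: evC. Qed.
Lemma ev2X : ev2 'X = tau. Proof. exact: evX. Qed.
Lemma ev3C c : ev3 c%:P = ev2 c. Proof. exact: evC. Qed.
Lemma ev3X : ev3 'X = E. Proof. exact: evX. Qed.

Lemma hderiv_rho : Delta * hderiv rho = q.
Proof.
have := congr1 (@hderiv K) rhoE; rewrite hderivM raddfB /= hderiv1 hderiv_exp => <-.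
by ring.
Qed.

Lemma ev1_exp_rho : ev1 exp_rho = q.
Proof. by rewrite /exp_rho rmorphM rmorphB rmorph1 /= ev1X. Qed.

Lemma ev1_disc_rho : ev1 disc_rho = Delta.
Proof. by rewrite /disc_rho rmorphB rmorphMn rmorph1 /= ev1X. Qed.

Lemma hderiv_ev1 p : Delta * hderiv (ev1 p) = ev1 (drho p).
Proof.
apply: hderiv_ev => [a|]; last by rewrite hderiv_rho -ev1_exp_rho.
by rewrite /= hderiv_const mulr0 raddf0.
Qed.

Lemma hderiv_ev2 p : Delta * hderiv (ev2 p) = ev2 (dtau p).
Proof.
apply: hderiv_ev => [|]; first exact: hderiv_ev1.
by rewrite hderiv_tau mulr1 -[RHS]/(ev2 _) ev2C ev1_disc_rho.
Qed.

Lemma ev2_dlogE : ev2 dlogE = rho * Delta + q * tau.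
Proof.
rewrite /dlogE -mul_polyC rmorphD /= ev2C !(rmorphM ev1) !(rmorphM ev2) /=.
by rewrite ev2C ev2X ev1_exp_rho ev1X ev1_disc_rho.
Qed.

Lemma hderiv_ev3 p : Delta * hderiv (ev3 p) = ev3 (dE p).
Proof.
apply: hderiv_ev => [|]; first exact: hderiv_ev2.
rewrite -[RHS]/(ev3 _) -mul_polyC rmorphM /= ev3X ev3C ev2_dlogE hderiv_texp hderivM hderiv_tau.
by rewrite -hderiv_rho; ring.
Qed.

Lemma drhoE p : drho p = exp_rho * p^`().
Proof.
rewrite /drho /= /dext (_ : map_poly _ p = 0) ?add0r //.
by apply/polyP => i; rewrite coef_map_id0 ?coef0.
Qed.

Lemma coef_dtau P i : (dtau P)`_i = drho P`_i + disc_rho * P`_i.+1 *+ i.+1.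
Proof. by rewrite /dtau /= /dext coefD coef_map_id0 ?raddf0 // coefCM coef_deriv mulrnAr. Qed.

Lemma coef_dE P i : (dE P)`_i = dtau P`_i + dlogE * P`_i *+ i.
Proof.
rewrite /dE [LHS]/= /dext coefD coef_map_id0 ?raddf0 //; congr (_ + _).
rewrite -scalerAl coefZ coefXM.
by case: i => [|i] /=; rewrite ?mulr0 // coef_deriv mulrnAr.
Qed.

(** A relation [p(rho) = 0] differentiates to [q p'(rho) = 0], so [p'] is a relation of smaller
    degree and vanishes; a constant relation is zero. *)
Lemma ev1_inj p : ev1 p = 0 -> p = 0.
Proof.
have [n] := ubnP (size p); elim: n p => // n IH p pn ep.
have p'0 : p^`() = 0.
  have [->|p0] := eqVneq p 0; first exact: deriv0.
  apply: IH; first exact: leq_trans (lt_size_deriv p0) _.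
  apply: (@hreg _ q); first exact: oner_neq0.
  by rewrite -ev1_exp_rho -(rmorphM ev1) /= -drhoE -hderiv_ev1 ep raddf0 mulr0.
have pC : p = (p`_0)%:P.
  apply/polyP => -[|i]; rewrite coefC //=.
  have := congr1 (fun r : {poly K} => r`_i) p'0; rewrite coef_deriv coef0 => /eqP.
  by rewrite mulrn_eq0 => /eqP.
move: ep; rewrite pC ev1C => /(congr1 (fun f : hseries K => f 0%N)) /= ->.
by rewrite polyC0.
Qed.

(* [b / c] would be minus a multiple of the primitive of [(1 - 2 rho) / (rho (1 - rho))],
   which is a logarithm; the proof compares leading coefficients. *)
Lemma tau_transcendental_step (b c : Prho) k : c != 0 ->
  c * (drho b + disc_rho * c *+ k.+1) = drho c * b -> False.
Proof.
move=> c0 e.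
pose t := (size c).-1; pose s := maxn t (size b).-1.
have szc : (size c <= t.+1)%N by rewrite /t; case: (size c).
have szb : (size b <= s.+1)%N.
  by apply: leq_trans (leqSpred _) _; rewrite ltnS leq_maxr.
have ct0 : c`_t != 0 by rewrite -/(lead_coef c) lead_coef_eq0.
pose V := c * ('X * b^`()) - ('X * c^`()) * b.
have sXd (p : {poly K}) a : (size p <= a.+1)%N ->
    (size ('X * p^`())%R <= a.+1)%N /\ ('X * p^`())`_a = p`_a *+ a.
  move=> pa; split; last by rewrite coefXM; case: a {pa} => [|a]; rewrite ?mulr0n //= coef_deriv.
  apply/leq_sizeP => j aj; rewrite coefXM; case: j aj => // j aj /=.
  by rewrite coef_deriv nth_default ?mul0rn // (leq_trans pa).
have Vtop : V`_(t + s) = c`_t * b`_s *+ s - c`_t * b`_s *+ t.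
  have [h1 h2] := sXd _ _ szb; have [h3 h4] := sXd _ _ szc.
  rewrite coefB !coefM_top // h2 h4; ring.
have szM (p r : {poly K}) a a' : (size p <= a.+1)%N -> (size r <= a'.+1)%N ->
    (size (p * r)%R <= (a + a').+1)%N.
  move=> h h'; apply: leq_trans (size_polyMleq _ _) _; lia.
have szV : (size V <= (t + s).+1)%N.
  have [h1 h2] := sXd _ _ szb; have [h3 h4] := sXd _ _ szc.
  apply: leq_trans (size_polyD _ _) _; rewrite size_polyN geq_max.
  by rewrite !szM.
have eV : V * (1 - 'X) = - (disc_rho * (c * c) *+ k.+1).
  move: e; rewrite !drhoE /V /exp_rho => e; apply/eqP; rewrite -subr_eq0; apply/eqP.
  transitivity (c * ('X * (1 - 'X) * b^`() + disc_rho * c *+ k.+1) - 'X * (1 - 'X) * c^`() * b).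
    by ring.
  by rewrite e subrr.
have sz1 : (size (1 - 'X : {poly K})%R <= 2)%N.
  by rewrite -size_polyN opprB size_XsubC.
have szD : (size disc_rho <= 2)%N.
  apply: leq_trans (size_polyD _ _) _; rewrite size_polyN size_poly1 geq_max /= -scaler_nat.
  by apply: leq_trans (size_scale_leq _ _) _; rewrite size_polyX.
have l1 : (1 - 'X : {poly K})`_1 = -1 by rewrite coefB coefX coef1 sub0r.
have lD : disc_rho`_1 = -2%:R by rewrite coefB coefMn coefX coef1 sub0r.
have := congr1 (fun r : {poly K} => r`_(t + s + 1)) eV.
rewrite coefM_top // l1 Vtop coefN coefMn.
(* Compare coefficients in degree [t + s + 1]: for [s = t] only the left side vanishes there, for
   [s > t] only the right side. *)
have [st|ts] := eqVneq s t.
  rewrite st subrr mul0r addnC coefM_top ?szM // lD coefM_top // => /esym/eqP.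
  rewrite oppr_eq0 mulrn_eq0 /= !mulf_eq0 (negPf ct0) oppr_eq0.
  by rewrite -[2%:R]/(1 *+ 2) mulrn_eq0 oner_eq0.
have lts : (t < s)%N by rewrite ltn_neqAle eq_sym ts leq_maxl.
have bs0 : b`_s != 0.
  have -> : s = (size b).-1 by move: lts; rewrite /s; lia.
  rewrite -/(lead_coef b) lead_coef_eq0; apply: contraTneq lts => b0.
  by rewrite /s b0 size_poly0 maxn0 ltnn.
rewrite [X in _ = - (X *+ _)]nth_default; last first.
  by apply: leq_trans (szM _ _ 1%N (t + t)%N szD (szM _ _ _ _ szc szc)) _; lia.
rewrite mul0rn oppr0 mulrN1 => /eqP; rewrite oppr_eq0 -mulrnBr ?(ltnW lts) //.
by rewrite mulrn_eq0 !mulf_eq0 (negPf ct0) (negPf bs0) subn_eq0 leqNgt lts.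
Qed.

(* In a relation [P] of minimal degree, [c * dtau P - drho c * P], where [c] is the
   leading coefficient, is a relation of smaller degree, hence zero. *)
Lemma ev2_inj P : ev2 P = 0 -> P = 0.
Proof.
have [n] := ubnP (size P); elim: n P => // n IH P Pn eP.
apply/eqP/negPn/negP => P0.
set c := lead_coef P; have c0 : c != 0 by rewrite lead_coef_eq0.
have sP : (0 < size P)%N by rewrite lt0n size_poly_eq0.
pose Q := c *: dtau P - drho c *: P.
have coefQ i : Q`_i = c * (drho P`_i + disc_rho * P`_i.+1 *+ i.+1) - drho c * P`_i.
  by rewrite coefB !coefZ coef_dtau.
have Q0 : Q = 0.
  apply: IH.
    apply: leq_trans (_ : size P <= n)%N; last by [].
    rewrite -(prednK sP) ltnS; apply/leq_sizeP => j; rewrite coefQ leq_eqVlt => /orP[/eqP <-|lj].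
      rewrite prednK // [P`_(size P)]nth_default // mulr0 mul0rn addr0.
      by rewrite -/(lead_coef P) -/c; ring.
    have -> : P`_j = 0 by rewrite nth_default // -(prednK sP).
    rewrite nth_default ?raddf0; last by rewrite -(prednK sP) ltnW.
    by rewrite /= !mulr0 mul0rn addr0 mulr0 subr0.
  rewrite /Q -!mul_polyC rmorphB !rmorphM /= -hderiv_ev2 eP.
  by rewrite raddf0 !mulr0 subrr.
case sz : (size P).-1 => [|k].
  have PC : P = c%:P by rewrite /c /lead_coef sz; apply: size1_polyC; lia.
  by move: eP; rewrite PC ev2C => /ev1_inj /eqP; rewrite (negPf c0).
have cE : P`_k.+1 = c by rewrite -sz.
(* The coefficient of [Q = 0] just below the leading degree is the excluded equation. *)
apply: (@tau_transcendental_step P`_k c k c0).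
by have := coefQ k; rewrite Q0 coef0 cE => /esym/subr0_eq.
Qed.

Lemma size_dtau P : (size (dtau P) <= size P)%N.
Proof.
apply/leq_sizeP => j Pj; rewrite coef_dtau !nth_default ?raddf0 //; last exact: leqW.
by rewrite mulr0 mul0rn addr0.
Qed.

(* As for [ev2_inj]; the two sides of the resulting equation have different
   degrees in [tau]. *)
Lemma ev3_inj P : ev3 P = 0 -> P = 0.
Proof.
have [n] := ubnP (size P); elim: n P => // n IH P Pn eP.
apply/eqP/negPn/negP => P0.
set c := lead_coef P; have c0 : c != 0 by rewrite lead_coef_eq0.
have sP : (0 < size P)%N by rewrite lt0n size_poly_eq0.
set m := (size P).-1.
pose u := dtau c + dlogE * c *+ m.
pose Q := c *: dE P - u *: P.
have coefQ i : Q`_i = c * (dtau P`_i + dlogE * P`_i *+ i) - u * P`_i.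
  by rewrite coefB !coefZ coef_dE.
have Q0 : Q = 0.
  apply: IH.
    apply: leq_trans (_ : size P <= n)%N; last by [].
    rewrite -(prednK sP) ltnS; apply/leq_sizeP => j; rewrite coefQ leq_eqVlt => /orP[/eqP <-|lj].
      by rewrite -/(lead_coef P) -/c /u -/m; ring.
    have -> : P`_j = 0 by rewrite nth_default // -(prednK sP).
    by rewrite raddf0 /= !mulr0 mul0rn addr0 mulr0 subr0.
  rewrite /Q -!mul_polyC rmorphB !rmorphM /= -hderiv_ev3 eP.
  by rewrite raddf0 !mulr0 subrr.
have low i : (i < m)%N -> P`_i = 0.
  move=> im; apply/eqP/negPn/negP => b0; set b := P`_i in b0.
  have e : c * dtau b - dtau c * b = c * b * dlogE *+ (m - i).
    have := coefQ i; rewrite Q0 coef0 -/b /u => e.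
    rewrite -[RHS]addr0 e mulrnBr ?(ltnW im) //; ring.
  have szc : (size c <= (size c).-1.+1)%N by rewrite leqSpred.
  have szb : (size b <= (size b).-1.+1)%N by rewrite leqSpred.
  have szw : (size dlogE <= 2)%N.
    apply: leq_trans (size_polyD _ _) _; rewrite geq_max (leq_trans (size_polyC_leq1 _)) //=.
    by apply: leq_trans (size_scale_leq _ _) _; rewrite size_polyX.
  have := congr1 (fun r : Ptau => r`_((size c).-1 + (size b).-1 + 1)) e.
  have szcb : (size (c * b)%R <= ((size c).-1 + (size b).-1).+1)%N.
    by apply: leq_trans (size_polyMleq _ _) _; lia.
  rewrite coefMn coefM_top // coefM_top // -!/(lead_coef _).
  rewrite nth_default; last first.
    apply: leq_trans (size_polyD _ _) _; rewrite size_polyN geq_max.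
    have := size_dtau b; have := size_dtau c => h1 h2.
    have aux x y x' y' : (x' <= x -> y' <= y -> (x' + y').-1 <= x.-1 + y.-1 + 1)%N by lia.
    by apply/andP; split; apply: leq_trans (size_polyMleq _ _) _; apply: aux.
  have [k ->] : exists k, (m - i = k.+1)%N by exists (m - i).-1; lia.
  have lc0 : lead_coef c != 0 by rewrite (lead_coef_eq0 c).
  have lb0 : lead_coef b != 0 by rewrite (lead_coef_eq0 b).
  move=> /esym/polyK_mulrn_eq0/eqP; rewrite !mulf_eq0 (negPf lc0) (negPf lb0) /=.
  rewrite /dlogE coefD coefC coefZ coefX add0r mulr1 /exp_rho mulf_eq0 polyX_eq0 /=.
  by rewrite -oppr_eq0 opprB polyXsubC_eq0.
have PE : P = c *: 'X^m.
  apply/polyP => j; rewrite coefZ coefXn.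
  case: (ltngtP j m) => [jm|jm|->]; rewrite ?mulr0 ?mulr1 //; first exact: low.
  by rewrite nth_default // -(prednK sP).
(* The relation is reduced to [c * E^m = 0], and [E^m] has constant coefficient 1, so it cancels. *)
move: eP; rewrite PE -mul_polyC rmorphM rmorphXn /= ev3X ev3C mulrC => eP.
have /ev2_inj/eqP : ev2 c = 0; last by rewrite (negPf c0).
apply: hreg eP; elim: (m) => [|k IHk]; first exact: oner_neq0.
by rewrite exprS hmul0E texp0 mul1r.
Qed.

End Independence.

(** * Poles *)

Section Poles.

Variable rho : hseries K.
Hypothesis rhoE : rho * (1 - rho) = hexp K.

Local Notation q := (hexp K).
Local Notation tau := (htau K).
Local Notation E := (texp rho).
Local Notation Delta := (1 - rho *+ 2).
Local Notation A := (pop_stacked_egf K).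
Local Notation N := (E + 1 - rho).
Local Notation ev := (ev3 rho).

(** The value [rho - 1] of [E] at which [N] vanishes. *)
Definition pole : Ptau := ('X - 1)%:P.
Definition denom : PE := 'X - pole%:P.
Definition disc : PE := disc_rho%:P%:P.
Definition exp_poly : PE := exp_rho%:P%:P.
Definition ddenom : PE := dlogE *: 'X - exp_poly.

Lemma ev_denom : ev denom = N.
Proof.
rewrite /denom /pole rmorphB /= ev3X ev3C ev2C rmorphB rmorph1 /= ev1X; ring.
Qed.

Lemma ev_disc : ev disc = Delta.
Proof. by rewrite /disc ev3C ev2C ev1_disc_rho. Qed.

Lemma ev_exp_poly : ev exp_poly = q.
Proof. by rewrite /exp_poly ev3C ev2C ev1_exp_rho. Qed.

Lemma hderiv_denom : Delta * hderiv N = ev ddenom.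
Proof.
have -> : hderiv N = hderiv (tau * rho) * E - hderiv rho.
  by rewrite raddfB raddfD /= hderiv1 addr0 hderiv_texp.
rewrite /ddenom -mul_polyC rmorphB rmorphM /= ev_exp_poly ev3X ev3C ev2_dlogE //.
by rewrite hderivM hderiv_tau -(hderiv_rho rhoE); ring.
Qed.

Lemma mul_hderivX (f g : hseries K) k :
  f * (g * hderiv (f ^+ k)) = g * hderiv f * f ^+ k *+ k.
Proof. by case: k => [|k]; rewrite hderivX /= ?exprS; ring. Qed.

(* [X] has a pole of order at most [s.+1] along [N = 0], where its leading
   coefficient is [v], up to a nonzero factor depending only on [s]. *)
Definition polar (X : hseries K) s (v : Ptau) :=
  exists P : PE, q * Delta ^+ (2 * s) * N ^+ s.+1 * X = ev P /\ P.[pole] = v.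

Lemma denom_pole : denom.[pole] = 0.
Proof. by rewrite /denom !hornerE subrr. Qed.

Lemma polar0 s : polar 0 s 0.
Proof. by exists 0; rewrite mulr0 rmorph0 horner0. Qed.

(** Algebraic independence enters here: the series determines the polynomial [P], hence its value at
    the pole. *)
Lemma polar_uniq s v : polar 0 s v -> v = 0.
Proof.
by case=> P [] /=; rewrite mulr0 => /esym/(ev3_inj rhoE) -> <-; rewrite horner0.
Qed.

Lemma polarD X Y s u v : polar X s u -> polar Y s v -> polar (X + Y) s (u + v).
Proof.
case=> P [eP vP] [Q [eQ vQ]]; exists (P + Q).
by rewrite mulrDr eP eQ rmorphD hornerD vP vQ.
Qed.

Lemma polar_sum (I : finType) (X : I -> hseries K) s v :
  (forall i, polar (X i) s (v i)) -> polar (\sum_i X i) s (\sum_i v i).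
Proof.
move=> h; elim/big_rec2: _ => [|i a b _]; first exact: polar0.
exact: polarD.
Qed.

Lemma polar_const X s v c : polar X s v -> polar (hconst c * X) s (c%:P%:P * v).
Proof.
case=> P [eP vP]; exists (c%:P%:P%:P * P).
by rewrite rmorphM hornerM hornerC vP mulrCA eP /= ev3C ev2C ev1C.
Qed.

Lemma polar_tau X s v : polar X s v -> polar (tau * X) s ('X * v).
Proof.
case=> P [eP vP]; exists ('X%:P * P).
by rewrite rmorphM hornerM hornerC vP mulrCA eP /= ev3C ev2X.
Qed.

Lemma polarS X s v : polar X s v -> polar X s.+1 0.
Proof.
case=> P [eP vP]; exists (disc ^+ 2 * denom * P); rewrite !hornerM denom_pole mulr0 mul0r.
split=> //; rewrite !rmorphM /= ev_disc ev_denom -eP mulnS exprD (exprS N s.+1); ring.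
Qed.

Lemma polar_lt X s s' v : (s < s')%N -> polar X s v -> polar X s' 0.
Proof.
elim: s' => // s' IH; rewrite ltnS leq_eqVlt => /orP[/eqP -> /polarS //|].
by move=> lt /(IH lt)/polarS.
Qed.

Definition pole_step : Ptau := disc.[pole] * ddenom.[pole].

Lemma polar_hderiv X s v : polar X s v -> polar (hderiv X) s.+1 (- (pole_step * v *+ s.+1)).
Proof.
case=> P [eP vP].
(* One new factor [Delta] lifts the derivation, the other clears [Delta' = - 2 q / Delta]. The
   bracket collects the logarithmic derivatives of [q], [Delta ^+ (2 * s)] and [N ^+ s.+1]; only the
   last survives at the pole. *)
exists (disc * denom * dE P - (disc ^+ 2 * denom - exp_poly * denom *+ (2 * (2 * s)) + disc * ddenom *+ s.+1) * P).
split; last first.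
  rewrite /pole_step; move: (dE P) ddenom => T n'.
  rewrite hornerD hornerN hornerM (hornerM disc) denom_pole hornerM vP hornerD hornerD hornerN.
  by rewrite !hornerMn (hornerM _ denom) (hornerM exp_poly) (hornerM disc n') denom_pole; ring.
set Z := Delta ^+ (2 * s) in eP *; set Y := N ^+ s.+1 in eP *.
have hz : Delta * (Delta * hderiv Z) = - (q * Z *+ (2 * (2 * s))).
  rewrite mul_hderivX -/Z -(hderiv_rho rhoE) raddfB raddfMn /= hderiv1; ring.
have hy : N * (Delta * hderiv Y) = ev ddenom * Y *+ s.+1.
  by rewrite mul_hderivX hderiv_denom.
have e : ev (dE P) = Delta * (q * Z * Y * X + q * hderiv Z * Y * X
    + q * Z * hderiv Y * X + q * Z * Y * hderiv X).
  by rewrite -(hderiv_ev3 rhoE) -eP !hderivM hderiv_exp; ring.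
move: (dE P) e => T e; move: ddenom hy => n' hy.
rewrite rmorphB (rmorphM _ _ P) (rmorphM _ _ T) /= -eP e.
rewrite rmorphD rmorphB !rmorphMn !rmorphM /=.
rewrite ev_disc ev_denom ev_exp_poly mulnS exprD -/Z (exprS N s.+1) -/Y.
transitivity (Delta ^+ 2 * N * q * Z * Y * X + N * q * Y * X * (Delta * (Delta * hderiv Z))
  + Delta * q * Z * X * (N * (Delta * hderiv Y)) + q * Delta ^+ 2 * Z * N * Y * hderiv X
  - (Delta ^+ 2 * N - q * N *+ (2 * (2 * s)) + Delta * ev n' *+ s.+1) * (q * Z * Y * X)).
  by rewrite hz hy; ring.
by ring.
Qed.

Definition egf_num : PE := ((1 - 'X)%:P%:P * ('X + 'X%:P%:P)) *+ 2 - denom.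

Lemma polar_egf : polar A 0 egf_num.[pole].
Proof.
exists egf_num; split=> //; rewrite muln0 expr0 mulr1 expr1 mulrAC pop_stacked_egfE.
transitivity (column (first_max_array K) * N *+ 2 - N); first by ring.
rewrite (column_first_max rhoE) /egf_num rmorphB rmorphMn rmorphM /= ev_denom ev3C ev2C.
by rewrite (rmorphD (ev3 rho)) /= ev3X ev3C ev2C rmorphB rmorph1 /= ev1X.
Qed.

Lemma egf_num_pole_neq0 : egf_num.[pole] != 0.
Proof.
have -> : egf_num.[pole] = ((1 - 'X) * ('X *+ 2 - 1) *+ 2)%:P.
  rewrite /egf_num hornerD hornerN denom_pole hornerMn hornerM hornerD !hornerC hornerX /pole.
  by rewrite subr0 -polyCD -polyCM -polyCMn; congr (_%:P); ring.
rewrite polyC_eq0; apply/eqP => /polyK_mulrn_eq0/eqP; rewrite mulf_eq0 => /orP[].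
  by rewrite -oppr_eq0 opprB polyXsubC_eq0.
by move/eqP/(congr1 (fun p : {poly K} => p.[0])); rewrite hornerD hornerN hornerMn hornerX hornerC mul0rn sub0r horner0 => /eqP; rewrite oppr_eq0 oner_eq0.
Qed.

(** In [ddenom.[pole]] the coefficient of [tau] is [q (rho - 1)], with [q] as a polynomial in
    [rho]. *)
Lemma pole_step_neq0 : pole_step != 0.
Proof.
have X0 : ('X : {poly K}) != 0 by rewrite polyX_eq0.
have Q0 : exp_rho != 0.
  by rewrite mulf_neq0 // -oppr_eq0 opprB polyXsubC_eq0.
rewrite mulf_neq0 //; last first.
  rewrite /ddenom hornerD hornerN hornerZ hornerX hornerC.
  apply/eqP => /(congr1 (fun p : Ptau => p`_1)).
  rewrite [RHS]coef0 coefB /pole coefMC !coefC /dlogE coefD coefC coefZ coefX /=.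
  move/eqP; rewrite subr0 add0r mulr1 mulf_eq0 (negPf Q0) /=.
  by rewrite polyXsubC_eq0.
rewrite hornerC polyC_eq0; apply/eqP => /(congr1 (fun p : {poly K} => p.[0])).
by rewrite /disc_rho hornerD hornerN hornerMn hornerX hornerC mul0rn subr0 horner0 => /eqP; rewrite oner_eq0.
Qed.

(** The leading coefficient of the [s]-th derivative of [A]. *)
Definition lead_polar s := egf_num.[pole] * \prod_(l < s) - (pole_step *+ l.+1).

Lemma lead_polar_neq0 s : lead_polar s != 0.
Proof.
rewrite mulf_neq0 ?egf_num_pole_neq0 //; apply/prodf_neq0 => l _.
rewrite oppr_eq0; apply/eqP => e; have := pole_step_neq0.
suff -> : pole_step = 0 by rewrite eqxx.
apply/polyP => i; rewrite coef0; apply: (@polyK_mulrn_eq0 _ l).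
by rewrite -coefMn e coef0.
Qed.

Lemma lead_polarS s : lead_polar s.+1 = - (pole_step * lead_polar s *+ s.+1).
Proof. by rewrite /lead_polar big_ord_recr /=; ring. Qed.

Lemma polar_hderiv_lead X s u :
  polar X s (u * lead_polar s) -> polar (hderiv X) s.+1 (u * lead_polar s.+1).
Proof.
move/polar_hderiv; congr polar; rewrite lead_polarS; ring.
Qed.

(* On exponential generating functions, this is the derivation of the ordinary
   generating function with the same coefficients. *)
Definition theta (X : hseries K) := hderiv (tau * hderiv X).

(** Each [theta] consists of two derivations and one multiplication by [tau]. *)
Lemma polar_iter_theta j : polar (iter j theta A) (2 * j) ('X^j * lead_polar (2 * j)).
Proof.
elim: j => [|j IH].
  by rewrite muln0 expr0 mul1r /lead_polar big_ord0 mulr1; exact: polar_egf.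
rewrite mulnS exprS; apply: polar_hderiv_lead.
by rewrite -mulrA; apply: polar_tau; exact: polar_hderiv_lead.
Qed.

Lemma polar_iter_hderiv n X s u :
  polar X s (u * lead_polar s) -> polar (iter n (@hderiv K) X) (n + s) (u * lead_polar (n + s)).
Proof. by move=> h; elim: n => //= n; exact: polar_hderiv_lead. Qed.

(** Among the pairs with nonzero coefficient, take one of maximal pole order [n - i + 2 j]. Pairs of
    equal order have different [j], so their leading coefficients carry different powers of [tau]
    and cannot cancel. *)
Lemma egf_operators_free k n (c : 'I_k -> 'I_n -> K) :
  \sum_(x : 'I_k * 'I_n) hconst (c x.1 x.2) *
     iter (n - x.2) (@hderiv K) (iter x.1 theta A) = 0 ->
  forall j i, c j i = 0.
Proof.
move=> e j i; apply/eqP/negPn/negP => c0.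
pose ord (x : 'I_k * 'I_n) := (n - x.2 + 2 * x.1)%N.
have [x cx xmax] := @arg_maxnP _ (j, i) (fun x => c x.1 x.2 != 0) ord c0.
pose v (y : 'I_k * 'I_n) : Ptau :=
  if ord y == ord x then (c y.1 y.2)%:P%:P * ('X^(y.1) * lead_polar (ord x)) else 0.
have /polar_uniq : polar 0 (ord x) (\sum_y v y).
  rewrite -e; apply: polar_sum => y; rewrite /v.
  have py := polar_iter_hderiv (n - y.2) (polar_iter_theta y.1).
  have [<-|ne] := eqVneq (ord y) (ord x); first exact: polar_const.
  have [c0y|cy] := eqVneq (c y.1 y.2) 0.
    by rewrite c0y rmorph0 mul0r; exact: polar0.
  have lt : (ord y < ord x)%N by rewrite ltn_neqAle ne; exact: xmax.
  by rewrite -(mulr0 (c y.1 y.2)%:P%:P); apply: polar_const; exact: polar_lt py.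
have -> : \sum_y v y = (\sum_(y | ord y == ord x) (c y.1 y.2)%:P%:P * 'X^(y.1)) * lead_polar (ord x).
  rewrite big_distrl [RHS]big_mkcond /=; apply: eq_bigr => y _; rewrite /v.
  by case: ifP => // _; rewrite mulrA.
move/eqP; rewrite mulf_eq0 (negPf (lead_polar_neq0 _)) orbF => /eqP.
move/(congr1 (fun p : Ptau => p`_x.1)); rewrite coef0 coef_sum.
rewrite (bigD1 x) //= coefCM coefXn eqxx mulr1 big1 ?addr0 => [/eqP|y /andP[/eqP oy yx]].
  by rewrite polyC_eq0 (negPf cx).
rewrite coefCM coefXn; case: eqP => [xy|]; rewrite ?mulr0 //.
case/eqP: yx; move: oy; rewrite /ord -xy.
case: x y xy {cx xmax v} => [x1 x2] [y1 y2] /= xy h.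
congr pair; apply/val_inj => //=.
by have := ltn_ord x2; have := ltn_ord y2; lia.
Qed.

End Poles.

(** * Transfer to the ordinary generating function *)

Lemma fps_derivn_theta j n : ratr (fps_derivn j pop_stacked_gf n) =
  iter j theta (pop_stacked_egf K) n.
Proof.
rewrite /fps_derivn; elim: j n => [|j IH] n; first by rewrite /= /pop_stacked_gf ratr_nat.
rewrite /= /fps_deriv rmorphM /= IH ratr_nat mulr_natl.
by rewrite /theta hderivE hmul_tau.
Qed.

Theorem pop_stacked_gf_not_dfinite (k : nat) (p : 'I_k.+1 -> {poly rat}) (q : {poly rat}) :
  (forall n : nat,
     fps_add
       (fps_sum (fun j : 'I_k.+1 =>
          fps_mul (fps_poly (p j)) (fps_derivn j pop_stacked_gf)))
       (fps_poly q) n = 0) ->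
  forall j, p j = 0.
Proof.
move=> hF j.
have [rho rhoE] := exists_rho.
(* In degree [n + m] the polynomial [q] contributes nothing, and the coefficient of [x^i F^(j)] is
   coefficient [m] of the [(n - i)]-th derivative of [theta^j A]. *)
pose n := maxn (size q) (\max_j size (p j)).
have pn i : (size (p i) <= n)%N.
  by apply: leq_trans (leq_maxr _ _); exact: leq_bigmax.
pose c (j : 'I_k.+1) (i : 'I_n) : K := ratr (p j)`_i.
suff c0 : forall j i, c j i = 0.
  apply/polyP => i; rewrite coef0; case: (ltnP i n) => [lt|le]; last first.
    by rewrite nth_default // (leq_trans (pn j)).
  by have /eqP := c0 j (Ordinal lt); rewrite fmorph_eq0 => /eqP.
apply: (egf_operators_free rhoE).
apply/funext => m; rewrite hzeroE.
have hsum (I : finType) (f : I -> hseries K) : (\sum_i f i) m = \sum_i f i m.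
  by elim/big_rec2: _ => [|i a b _ <-]; rewrite ?hzeroE ?haddE.
rewrite hsum.
have hc a (f : hseries K) : (hconst a * f) m = a * f m.
  by elim: (m) f => // l IH f; rewrite hmulSE hderiv_const mul0r hzeroE add0r IH.
under eq_bigr => x _ do rewrite hc.
rewrite -(pair_bigA _ (fun j i => c j i * iter (n - i) (@hderiv K) (iter j theta (pop_stacked_egf K)) m)) /=.
have := congr1 (fun x : rat => ratr x : K) (hF (n + m)%N).
rewrite /fps_add /fps_sum /fps_mul /fps_poly [q`__]nth_default ?addr0 ?rmorph0; last first.
  by apply: leq_trans (leq_addr _ _); exact: leq_maxl.
rewrite raddf_sum => h; rewrite -[RHS]h; apply: eq_bigr => l _ /=.
rewrite raddf_sum.
rewrite [RHS](bigID (fun i : 'I_(n + m).+1 => (i < n)%N)) /= [X in _ + X]big1 ?addr0; last first.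
  move=> i; rewrite -leqNgt => ni.
  by rewrite nth_default ?mul0r ?rmorph0 // (leq_trans (pn l)).
have le : (n <= (n + m).+1)%N by lia.
rewrite (big_ord_widen_cond _ predT (fun i => ratr (p l)`_i *
   iter (n - i) (@hderiv K) (iter l theta (pop_stacked_egf K)) m) le).
apply: eq_bigr => i /= lt; rewrite rmorphM /= fps_derivn_theta; congr (_ * _).
have iterE a (f : hseries K) b : iter a (@hderiv K) f b = f (a + b)%N.
  by elim: a b => //= a IH b; rewrite hderivE IH addnS.
by rewrite iterE addnBAC // ltnW.
Qed.

Theorem mainTheorem7 (k : nat) (p : 'I_k.+1 -> {poly rat}) (q : {poly rat})
  (hpk : p ord_max != 0)
  (hF : forall n : nat,
     fps_add
       (fps_sum (fun j : 'I_k.+1 =>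
          fps_mul (fps_poly (p j)) (fps_derivn j pop_stacked_gf)))
       (fps_poly q) n = 0)
  (d : nat)
  (hd : d = maxn (degree q) (\max_(j < k.+1) degree (p j))) :
  (1000 < (k + 2) * (d + 1))%N.
Proof.
by have := hpk; rewrite (pop_stacked_gf_not_dfinite hF) eqxx.
Qed.
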